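(* Let $(\mathcal M,\xi,\psi,\gamma)$ be an ambient Leibnizian structure and let $(N,A)$ be an invariant Leibnizian pair. There is a unique (possibly torsional) ambient Galilean connection $\overset{N,A}\nabla$ compatible with $(\mathcal M,\xi,\psi,\gamma)$ such that the torsional ambient gravitational fieldstrength $\big(\overset A\Sigma,\overset{N,A}{\mathcal U}\big)$ measured by $(N,A)$ with respect to $\overset{N,A}\nabla$ vanishes.
   Context: Everything is smooth. An ambient structure $(\mathcal M,\xi)$ is a manifold of dimension $d+2$ with a complete nowhere-vanishing vector field $\xi$ whose flow is a free proper $\mathbb R$-action (so $\mathcal M\to\mathcal M/\mathbb R$ is a principal $\mathbb R$-bundle). An ambient Leibnizian structure $(\mathcal M,\xi,\psi,\gamma)$: an ambient structure, a nowhere-vanishing 1-form $\psi$ with $\psi(\xi)=0$, and a positive semi-definite $\gamma\in\Gamma(\vee^2(\ker\psi)^* )$ with radical spanned by $\xi$. An ambient Galilean connection is a Koszul connection $\nabla$ on $\mathcal M$ with $\nabla\xi=0$, $\nabla\psi=0$ and $X[\gamma(V,W)]=\gamma(\nabla_XV,W)+\gamma(V,\nabla_XW)$ for all vector fields $X$ and $V,W\in\Gamma(\ker\psi)$. Torsion: $T(X,Y)=\nabla_XY-\nabla_YX-[X,Y]$. An invariant Leibnizian pair is $(N,A)$ with $N$ a vector field, $A$ a 1-form, $\psi(N)=1$, $A(\xi)=1$, $A(N)=0$, $\mathcal L_\xi N=0=\mathcal L_\xi A$. Put $\overset N\gamma(X,Y)=\gamma(X-\psi(X)N,\,Y-\psi(Y)N)$.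 The torsional ambient gravitational fieldstrength of $\nabla$ measured by $(N,A)$ is the pair $(\overset A\Sigma,\overset{N,A}{\mathcal U})$ of tensor fields defined, for all vector fields $X,Y,Z$, by $$\overset A\Sigma(X,Y)=A(\nabla_XY)-X[A(Y)]+\tfrac12dA(X,Y),$$ $$\overset{N,A}{\mathcal U}(Z|X,Y)=\tfrac12\overset N\gamma(T(X,Y),Z)-\tfrac14\big(A(X)\mathcal L_\xi\overset N\gamma(Y,Z)-A(Y)\mathcal L_\xi\overset N\gamma(X,Z)\big)-\tfrac12\psi(Z)\big(\overset N\gamma(\nabla_XN,Y)-\overset N\gamma(\nabla_YN,X)\big).$$ Convention: $dA(X,Y)=X[A(Y)]-Y[A(X)]-A([X,Y])$. *)

(* Defs.v *)
From HB Require Import structures.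
From mathcomp Require Import all_boot all_order all_algebra.
From mathcomp Require Import all_classical all_reals all_analysis.
From mathcomp Require Import ring.

Set Implicit Arguments.
Unset Strict Implicit.
Unset Printing Implicit Defensive.

Import Order.TTheory GRing.Theory Num.Theory.
Import numFieldNormedType.Exports.

Local Open Scope classical_set_scope.
Local Open Scope ring_scope.

Section smooth_maps.
Context {R : realType} {n : nat}.

(* The domain is finite dimensional, so asking every directional derivative to
   be C^k is the same as asking the differential to be C^k. *)
Fixpoint C_k_on {W : normedModType R} (k : nat) (U : set 'rV[R]_n)
    (f : 'rV[R]_n -> W) : Prop :=
  if k is k'.+1 then
    (forall x, U x -> differentiable f x) /\
    (forall v, C_k_on k' U ('D_v f))
  else forall x, U x -> {for x, continuous f}.

Definition smooth_on {W : normedModType R} (U : set 'rV[R]_n)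
  (f : 'rV[R]_n -> W) := forall k, C_k_on k U f.

Lemma near_differentiable {W : normedModType R} (f g : 'rV[R]_n -> W) x :
  (\near x, f x = g x) -> differentiable f x -> differentiable g x.
Proof.
move=> fg df; have -> : g = f + (g - f) by rewrite addrC subrK.
apply: differentiableD => //; have : \near x, (g - f) x = 0.
  by near=> y; rewrite !fctE (near fg y)// subrr.
move: (g - f) => h h0; apply/diffP.
apply: (@getPex _ (fun dh : {linear 'rV[R]_n -> W} => continuous dh /\
  forall y, h y = h (lim (nbhs x)) + dh (y - lim (nbhs x))
              +o_(y \near x) (y - lim (nbhs x)))).
exists (\0 : {linear _ -> _}); split; first exact: cst_continuous.
have E : h = (fun y => h (lim (nbhs x)) + (\0 : 'rV[R]_n -> W) (y - lim (nbhs x)))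
    +o_ (nbhs x) (fun y => y - lim (nbhs x)).
  apply/eqaddoP => _/posnumP[e]; near=> y.
  rewrite !fctE /= lim_id// (nbhs_singleton h0) (near h0 y)//.
  by rewrite addr0 subr0 normr0 mulr_ge0.
by move=> y; rewrite [LHS](congr1 (@^~ y) E).
Unshelve. all: by end_near. Qed.

Lemma eq_C_k_on {W : normedModType R} k U (f g : 'rV[R]_n -> W) : open U ->
  {in U, f =1 g} -> C_k_on k U f -> C_k_on k U g.
Proof.
move=> oU; have near_fg (h h' : 'rV[R]_n -> W) x :
    {in U, h =1 h'} -> U x -> \near x, h x = h' x.
  by move=> hh' Ux; near=> y; apply: hh'; rewrite inE; near: y;
    exact: open_nbhs_nbhs.
elim: k f g => [|k IH] f g fg /=.
  move=> cf x Ux; have cfx : f @ x --> f x := cf x Ux.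
  have gx : f x = g x by apply: fg; rewrite inE.
  suff : g @ x --> g x by [].
  rewrite -gx; apply: cvg_trans cfx.
  by apply: (@near_eq_cvg _ _ _ (nbhs_filter x)); exact: near_fg.
move=> [df Df]; split=> [x Ux|v].
  by apply: near_differentiable (df _ Ux); exact: near_fg.
by apply: IH (Df v) => x /[!inE] Ux; apply: near_eq_derive; exact: near_fg.
Unshelve. all: by end_near. Qed.

Lemma C_k_onW {W : normedModType R} k U (f : 'rV[R]_n -> W) :
  C_k_on k.+1 U f -> C_k_on k U f.
Proof.
elim: k f => [|k IH] f [df Df]; last by split=> // v; exact: IH (Df v).
by move=> x Ux; exact/differentiable_continuous/df.
Qed.

Lemma C_k_on_cst {W : normedModType R} k U (a : W) : C_k_on k U (cst a).
Proof.
elim: k a => [|k IH] a /=; first by move=> x _; exact: cst_continuous.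
split=> [x _|v]; first exact: differentiable_cst.
by rewrite (_ : 'D_v _ = cst 0)//; apply/funext => x; rewrite derive_cst.
Qed.

Lemma C_k_onB {W : normedModType R} k U (f g : 'rV[R]_n -> W) : open U ->
  C_k_on k U f -> C_k_on k U g -> C_k_on k U (f - g).
Proof.
move=> oU; elim: k f g => [|k IH] f g /=.
  by move=> cf cg x Ux; exact: (@cvgB _ _ _ _ _ f g _ _ (cf x Ux) (cg x Ux)).
move=> [df Df] [dg Dg]; split=> [x Ux|v].
  by apply: differentiableB; [exact: df|exact: dg].
apply: eq_C_k_on (IH _ _ (Df v) (Dg v)) => // x /[!inE] Ux.
by rewrite deriveB//; apply: diff_derivable; [exact: df|exact: dg].
Qed.

Lemma C_k_onD {W : normedModType R} k U (f g : 'rV[R]_n -> W) : open U ->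
  C_k_on k U f -> C_k_on k U g -> C_k_on k U (f + g).
Proof.
move=> oU Cf Cg; rewrite -[g]opprK -[- g]sub0r.
by apply: C_k_onB => //; apply: C_k_onB => //; exact: C_k_on_cst.
Qed.

Lemma C_k_onM k U (f g : 'rV[R]_n -> R) : open U ->
  C_k_on k U f -> C_k_on k U g -> C_k_on k U (f * g).
Proof.
move=> oU; elim: k f g => [|k IH] f g.
  by move=> cf cg x Ux; exact: (@cvgM _ _ _ _ f g _ _ (cf x Ux) (cg x Ux)).
move=> Cf Cg; have [df Df] := Cf; have [dg Dg] := Cg.
split=> [x Ux|v].
  by apply: differentiableM; [exact: df|exact: dg].
apply: (@eq_C_k_on _ _ _ (f * 'D_v g + g * 'D_v f)) => //.
  move=> x /[!inE] Ux.
  have [dfv dgv] : derivable f x v /\ derivable g x v.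
    by split; apply: diff_derivable; [exact: df|exact: dg].
  by rewrite deriveM.
by apply: C_k_onD => //; apply: IH; do ?[exact: Df|exact: Dg|exact: C_k_onW].
Qed.

End smooth_maps.

Record chart (R : realType) (n : nat) (M : topologicalType) := Chart {
  chart_dom : set M ;
  chart_fun : M -> 'rV[R]_n ;
  chart_inv : 'rV[R]_n -> M }.

Definition chart_cod (R : realType) (n : nat) (M : topologicalType)
  (c : chart R n M) : set 'rV[R]_n := chart_fun c @` chart_dom c.

Definition homeo_chart (R : realType) (n : nat) (M : topologicalType)
    (c : chart R n M) : Prop :=
  [/\ open (chart_dom c), open (chart_cod c),
      forall p, chart_dom c p -> chart_inv c (chart_fun c p) = p,
      {within chart_dom c, continuous (chart_fun c)} &
      {within chart_cod c, continuous (chart_inv c)}].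

Record smooth_manifold (R : realType) (n : nat) := SmoothManifold {
  manifold_sort :> topologicalType ;
  atlas : set (chart R n manifold_sort) ;
  manifold_hausdorff : hausdorff_space manifold_sort ;
  manifold_second_countable : @second_countable manifold_sort ;
  atlas_homeo : forall c, atlas c -> homeo_chart c ;
  atlas_cover : forall p, exists2 c, atlas c & chart_dom c p ;
  atlas_smooth : forall c c', atlas c -> atlas c' ->
    smooth_on (chart_fun c @` (chart_dom c `&` chart_dom c'))
              (chart_fun c' \o chart_inv c) }.

Section smooth_functions.
Context {R : realType} {n : nat} (M : smooth_manifold R n).

Definition smooth_function (f : M -> R) : Prop :=
  forall c, atlas c -> smooth_on (chart_cod c) (f \o chart_inv c).

Definition smooth_function_pred : {pred M -> R} :=
  fun f => `[< smooth_function f >].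

(* C^oo(M), a commutative ring and a vector space over R *)
Record smooth_fun := SmoothFun {
  smooth_fun_val :> M -> R ;
  _ : smooth_fun_val \in smooth_function_pred }.

HB.instance Definition _ := [isSub for smooth_fun_val].
HB.instance Definition _ := [Choice of smooth_fun by <:].

Fact smooth_subring_closed : subring_closed smooth_function_pred.
Proof.
split=> [|f g|f g].
- by apply/asboolP => c _ k; exact: C_k_on_cst.
- move=> /asboolP Cf /asboolP Cg; apply/asboolP => c ac k.
  have [_ oc _ _ _] := atlas_homeo ac.
  exact: (C_k_onB oc (Cf c ac k) (Cg c ac k)).
- move=> /asboolP Cf /asboolP Cg; apply/asboolP => c ac k.
  have [_ oc _ _ _] := atlas_homeo ac.
  exact: (C_k_onM oc (Cf c ac k) (Cg c ac k)).
Qed.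

HB.instance Definition _ := GRing.isSubringClosed.Build (M -> R)
  smooth_function_pred smooth_subring_closed.
HB.instance Definition _ := GRing.SubChoice_isSubComPzRing.Build (M -> R)
  smooth_function_pred smooth_fun smooth_subring_closed.

Fact smooth_submod_closed :
  subsemimod_closed (smooth_function_pred : {pred M -> R^o}).
Proof.
split; first by split; [exact: rpred0|exact: rpredD].
move=> a f /asboolP Cf; apply/asboolP => c ac k.
have [_ oc _ _ _] := atlas_homeo ac.
exact: (C_k_onM oc (C_k_on_cst k _ a) (Cf c ac k)).
Qed.

HB.instance Definition _ := GRing.SubZmodule_isSubLmodule.Build R (M -> R^o)
  smooth_function_pred smooth_fun smooth_submod_closed.

End smooth_functions.

Section vector_fields.
Context {R : realType} {n : nat} (M : smooth_manifold R n).
Local Notation F := (smooth_fun M).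

Definition derivation (D : F -> F) : Prop :=
  (forall (a : R) (f g : F), D (a *: f + g) = a *: D f + D g) /\
  (forall f g : F, D (f * g) = D f * g + f * D g).

Definition derivation_pred : {pred F -> F} := fun D => `[< derivation D >].

(* A vector field X is identified with the derivation f |-> X[f] of the
   R-algebra C^oo(M); its value at p is the tangent vector f |-> X f p. *)
Record vector_field := VectorField {
  vector_field_val :> F -> F ;
  _ : vector_field_val \in derivation_pred }.

HB.instance Definition _ := [isSub for vector_field_val].
HB.instance Definition _ := [Choice of vector_field by <:].

Fact derivation_submod_closed :
  subsemimod_closed (derivation_pred : {pred F -> F^o}).
Proof.
split; first split.
- apply/asboolP; have zE h : (0 : F -> F^o) h = 0 by [].
  by split=> [a f g|f g]; rewrite !zE ?scaler0 ?mul0r ?mulr0 addr0.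
- move=> X Y /asboolP[Xl XM] /asboolP[Yl YM]; apply/asboolP.
  split=> [a f g|f g].
    by rewrite !fctE Xl Yl scalerDr addrACA.
  by rewrite !fctE XM YM mulrDl mulrDr addrACA.
- move=> h X /asboolP[Xl XM]; apply/asboolP.
  have hE f : (h *: (X : F -> F^o)) f = h * X f by [].
  split=> [a f g|f g]; rewrite !hE ?Xl ?XM mulrDr; congr (_ + _).
  + by apply/val_inj/funext => p; exact: mulrCA.
  + by rewrite mulrA.
  + by rewrite mulrCA.
Qed.

HB.instance Definition _ := GRing.SubChoice_isSubLmodule.Build F (F -> F^o)
  derivation_pred vector_field derivation_submod_closed.

Lemma vector_fieldP (X : vector_field) : derivation X.
Proof. by case: X => D /= /asboolP. Qed.

Fact lie_bracket_subproof (X Y : vector_field) :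
  (fun f => X (Y f) - Y (X f)) \in derivation_pred.
Proof.
have [Xl XM] := vector_fieldP X; have [Yl YM] := vector_fieldP Y.
have XD f g : X (f + g) = X f + X g by have := Xl 1 f g; rewrite !scale1r.
have YD f g : Y (f + g) = Y f + Y g by have := Yl 1 f g; rewrite !scale1r.
apply/asboolP; split=> [a f g|f g].
  by rewrite Xl Yl Xl Yl scalerBr opprD addrACA.
rewrite XM YM XD YD !XM !YM; ring.
Qed.

Definition lie_bracket (X Y : vector_field) : vector_field :=
  VectorField (lie_bracket_subproof X Y).

Definition one_form := {linear vector_field -> F | *%R}.

End vector_fields.

Section ambient_structures.
Context {R : realType} {n : nat} {M : smooth_manifold R n}.
Local Notation F := (smooth_fun M).
Local Notation VF := (vector_field M).
Implicit Types (xi N V W X Y Z : VF) (psi A : one_form M).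
Implicit Types (gamma : VF -> VF -> F) (nabla : VF -> VF -> VF).

(* A curve u with (f o u)' = xi[f] o u for every smooth f is an integral curve
   of xi; a global flow is automatically jointly smooth in (t, p). *)
Definition is_global_flow xi (phi : R -> M -> M) : Prop :=
  [/\ forall p, phi 0 p = p,
      forall s t p, phi (s + t) p = phi s (phi t p) &
      forall p (f : F) (t : R),
        is_derive t 1 (fun s : R => f (phi s p)) (xi f (phi t p))].

Definition free_action (phi : R -> M -> M) : Prop :=
  forall t p, phi t p = p -> t = 0.

Definition proper_action (phi : R -> M -> M) : Prop :=
  forall K : set (M * M)%type, compact K ->
    compact [set tp : (R * M)%type | K (phi tp.1 tp.2, tp.2)].

Record ambient_structure xi : Prop := AmbientStructure {
  ambient_nonvanishing : forall p, exists f : F, xi f p <> 0 ;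
  ambient_flow : exists phi : R -> M -> M,
    [/\ is_global_flow xi phi, free_action phi & proper_action phi] }.

(* gamma stands for a section of \vee^2 (ker psi)^*: its values outside
   ker psi are irrelevant junk. *)
Record ambient_leibnizian xi psi gamma : Prop := AmbientLeibnizian {
  leibnizian_ambient : ambient_structure xi ;
  leibnizian_clock_nonvanishing : forall p, exists X, psi X p <> 0 ;
  leibnizian_clock_xi : psi xi = 0 ;
  leibnizian_linear : forall (f : F) V V' W,
    psi V = 0 -> psi V' = 0 -> psi W = 0 ->
    gamma (f *: V + V') W = f * gamma V W + gamma V' W ;
  leibnizian_sym : forall V W, psi V = 0 -> psi W = 0 ->
    gamma V W = gamma W V ;
  leibnizian_semidefinite : forall V p, psi V = 0 -> 0 <= gamma V V p ;
  leibnizian_radical : forall V p, psi V = 0 ->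
    (forall W, psi W = 0 -> gamma V W p = 0) <->
    (exists c : R, forall f : F, V f p = c * xi f p) }.

Record koszul_connection nabla : Prop := KoszulConnection {
  connection_linear : forall (f : F) X X' Y,
    nabla (f *: X + X') Y = f *: nabla X Y + nabla X' Y ;
  connection_additive : forall X Y Y', nabla X (Y + Y') = nabla X Y + nabla X Y' ;
  connection_leibniz : forall X (f : F) Y,
    nabla X (f *: Y) = X f *: Y + f *: nabla X Y }.

Record ambient_galilean_connection xi psi gamma nabla : Prop :=
  AmbientGalileanConnection {
  galilean_connection : koszul_connection nabla ;
  galilean_xi : forall X, nabla X xi = 0 ;
  galilean_psi : forall X Y, X (psi Y) - psi (nabla X Y) = 0 ;
  galilean_gamma : forall X V W, psi V = 0 -> psi W = 0 ->
    X (gamma V W) = gamma (nabla X V) W + gamma V (nabla X W) }.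

Definition torsion nabla X Y : VF := nabla X Y - nabla Y X - lie_bracket X Y.

Definition exterior_derivative A X Y : F :=
  X (A Y) - Y (A X) - A (lie_bracket X Y).

Definition lie_derivative_form xi A X : F := xi (A X) - A (lie_bracket xi X).

Definition lie_derivative_bilinear xi (g : VF -> VF -> F) X Y : F :=
  xi (g X Y) - g (lie_bracket xi X) Y - g X (lie_bracket xi Y).

Record invariant_leibnizian_pair xi psi N A : Prop := InvariantLeibnizianPair {
  pair_psi_N : psi N = 1 ;
  pair_A_xi : A xi = 1 ;
  pair_A_N : A N = 0 ;
  pair_N_invariant : lie_bracket xi N = 0 ;
  pair_A_invariant : forall X, lie_derivative_form xi A X = 0 }.

Definition transverse_metric psi gamma N X Y : F :=
  gamma (X - psi X *: N) (Y - psi Y *: N).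

Definition fieldstrength_Sigma nabla A X Y : F :=
  A (nabla X Y) - X (A Y) + (2^-1 : R) *: exterior_derivative A X Y.

Definition fieldstrength_U xi psi gamma nabla N A Z X Y : F :=
  let gN := transverse_metric psi gamma N in
  let Lg := lie_derivative_bilinear xi gN in
  (2^-1 : R) *: gN (torsion nabla X Y) Z
  - (4^-1 : R) *: (A X * Lg Y Z - A Y * Lg X Z)
  - (2^-1 : R) *: (psi Z * (gN (nabla X N) Y - gN (nabla Y N) X)).

Definition vanishing_fieldstrength xi psi gamma nabla N A : Prop :=
  (forall X Y, fieldstrength_Sigma nabla A X Y = 0) /\
  (forall Z X Y, fieldstrength_U xi psi gamma nabla N A Z X Y = 0).

End ambient_structures.

(* Main.v *)
Require Import Defs.
From HB Require Import structures.
From mathcomp Require Import all_boot all_order all_algebra.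
From mathcomp Require Import all_classical all_reals all_analysis.
From mathcomp Require Import ring lra.

(** Let g be the transverse metric measured by N, extended by zero to xi and N.
    Compatibility with psi and the vanishing of Sigma prescribe psi(nabla_X Y)
    and A(nabla_X Y), so only the products g(nabla_X Y, Z) with psi Z = A Z = 0
    remain to be found.  Evaluating U = 0 on Z = N shows that g(nabla_X N, Y) is
    symmetric in X and Y; then U = 0 prescribes the g-components of the torsion
    and the non-metricity terms of the usual Koszul computation cancel, so that
    Koszul's formula determines g(nabla_X Y, Z).  Conversely, the connection so
    defined has all the required properties, because
    g(nabla_X N, Y) = (L_N g)(X, Y) / 2 is symmetric.

    For existence the Koszul functional must be represented by a vector field.
    The form h = g + psi psi + A A is pointwise definite, so h(V, _) = alpha is
    solved near each point by inverting the Gram matrix of a local frame, and by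
    uniqueness the local solutions agree pointwise and define a derivation.  The
    local frame comes from Hadamard's lemma: a derivation of C^oo(M) acts near p
    as \sum_i X[x_i] d/dx_i for cut-off coordinates x_i. *)

Set Implicit Arguments.
Unset Strict Implicit.
Unset Printing Implicit Defensive.

Import Order.TTheory GRing.Theory Num.Theory.
Import numFieldNormedType.Exports.

Local Open Scope classical_set_scope.
Local Open Scope ring_scope.

(** * Smooth maps between open sets of R^n *)

Section smooth_maps_theory.
Context {R : realType} {n : nat}.
Implicit Types (U V : set 'rV[R]_n) (f g : 'rV[R]_n -> R) (x v : 'rV[R]_n).

(** Continuity and derivatives are those of the whole space, never relative to [U], so the condition
    splits over the points of [U]. *)
Lemma C_k_on_pointwise {W : normedModType R} k U (f : 'rV[R]_n -> W) :
  C_k_on k U f <-> forall x, U x -> C_k_on k [set x] f.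
Proof.
elim: k f => [|k IH] f /=; split.
- by move=> cf x Ux _ ->; exact: cf.
- by move=> cf x Ux; exact: (cf x Ux x erefl).
- move=> [df Df] x Ux; split=> [_ ->|v]; first exact: df.
  by have /IH := Df v; exact.
- move=> Cf; split=> [x Ux|v]; first by have [df _] := Cf x Ux; exact: df.
  by apply/IH => x Ux; have [_] := Cf x Ux; exact.
Qed.

Lemma C_k_on_subset {W : normedModType R} k U V (f : 'rV[R]_n -> W) :
  V `<=` U -> C_k_on k U f -> C_k_on k V f.
Proof.
by move=> VU /C_k_on_pointwise Cf; apply/C_k_on_pointwise => x /VU; exact: Cf.
Qed.

Lemma smooth_onB U f g : open U ->
  smooth_on U f -> smooth_on U g -> smooth_on U (f - g).
Proof. by move=> oU Cf Cg k; exact: C_k_onB. Qed.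

Lemma smooth_onM U f g : open U ->
  smooth_on U f -> smooth_on U g -> smooth_on U (f * g).
Proof. by move=> oU Cf Cg k; exact: C_k_onM. Qed.

Lemma C_k_on_sum m k U (F : 'I_m -> 'rV[R]_n -> R) : open U ->
  (forall i, C_k_on k U (F i)) -> C_k_on k U (\sum_i F i).
Proof.
move=> oU CF; elim/big_ind : _ => // [|f g]; last exact: C_k_onD.
exact: C_k_on_cst.
Qed.

Lemma smooth_on_derive U f v : smooth_on U f -> smooth_on U ('D_v f).
Proof. by move=> Cf k; exact: (Cf k.+1).2. Qed.

Lemma smooth_on_differentiable {W : normedModType R} U (f : 'rV[R]_n -> W) x :
  smooth_on U f -> U x -> differentiable f x.
Proof. by move=> /(_ 1%N)[df _]; exact: df. Qed.

(** Induction on [k]: the derivative of 1/f is -(1/f)^2 times that of [f], and the induction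
    hypothesis covers 1/f. *)
Lemma C_k_onV k U f : open U -> (forall x, U x -> f x != 0) ->
  C_k_on k U f -> C_k_on k U (fun x => (f x)^-1).
Proof.
move=> oU f0; elim: k => [|k IH] Cf.
  by move=> x Ux; exact: (@cvgV _ _ _ _ f _ (f0 x Ux) (Cf x Ux)).
have [df Df] := Cf; split=> [x Ux|v].
  by apply: differentiableV; [exact: df|exact: f0].
apply: (@eq_C_k_on _ _ _ k U
    (- ((fun x => (f x)^-1) * (fun x => (f x)^-1) * 'D_v f))) => //.
  move=> x /[!inE] Ux; rewrite deriveV ?f0//; last first.
    by apply: diff_derivable; exact: df.
  by rewrite !fctE -mulNr -expr2 exprVn.
rewrite -[- _]sub0r; apply: C_k_onB => //; first exact: C_k_on_cst.
have CV := IH (C_k_onW Cf).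
apply: C_k_onM => //; last exact: Df.
exact: C_k_onM.
Qed.

Lemma derive_coord (j : 'I_n) x v :
  'D_v (fun y : 'rV[R]_n => y 0 j) x = v 0 j.
Proof.
rewrite deriveE; last exact: differentiable_coord.
(* A coordinate is packed as a continuous linear map, hence is its own differential. *)
pose c := fun y : 'rV[R]_n => y 0 j.
have cl : linear c by move=> a y z; rewrite /c !mxE.
pose L : {linear 'rV[R]_n -> R^o} := HB.pack c (GRing.isLinear.Build _ _ _ _ c cl).
rewrite (_ : (fun y : 'rV[R]_n => y 0 j) = L)// diff_lin//.
exact: coord_continuous.
Qed.

Lemma smooth_on_coord (j : 'I_n) U : smooth_on U (fun y : 'rV[R]_n => y 0 j).
Proof.
case=> [|k] /=; first by move=> x _; exact: coord_continuous.
split=> [x _|v]; first exact: differentiable_coord.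
rewrite (_ : 'D_v _ = cst (v 0 j)); first exact: C_k_on_cst.
by apply/funext => x; rewrite derive_coord.
Qed.

Lemma derive_sum_basis f x v : differentiable f x ->
  'D_v f x = \sum_j v 0 j * 'D_(delta_mx 0 j) f x.
Proof.
move=> df; rewrite deriveE// {1}[v]row_sum_delta linear_sum.
by apply: eq_bigr => j _; rewrite linearZ deriveE.
Qed.

End smooth_maps_theory.

(** * Chain rule and composition of C^k maps *)

Section smooth_composition.
Context {R : realType} {n m : nat}.

Lemma derive_comp_coord (f : 'rV[R]_m -> R) (h : 'rV[R]_n -> 'rV[R]_m) x v :
  differentiable h x -> differentiable f (h x) ->
  'D_v (f \o h) x =
  \sum_j 'D_v (fun y => h y 0 j) x * 'D_(delta_mx 0 j) f (h x).
Proof.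
move=> dh df; rewrite deriveE; last exact: differentiable_comp.
rewrite diff_comp//= -deriveE// derive_sum_basis//.
apply: eq_bigr => j _; congr (_ * _).
rewrite [RHS](_ : _ = 'D_v ((fun y : 'rV[R]_m => y 0 j) \o h) x)//.
have dc : differentiable (fun y : 'rV[R]_m => y 0 j) (h x).
  exact: differentiable_coord.
rewrite deriveE; last exact: differentiable_comp.
by rewrite (diff_comp dh dc)/= -[RHS](deriveE _ dc) derive_coord.
Qed.

Lemma C_k_on_coord k U (h : 'rV[R]_n -> 'rV[R]_m) j : open U ->
  C_k_on k U h -> C_k_on k U (fun x => h x 0 j).
Proof.
move=> oU; elim: k h => [|k IH] h.
  move=> ch x Ux; apply: (@continuous_comp _ _ _ h (fun y : 'rV_m => y 0 j)).
    exact: ch.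
  exact: coord_continuous.
move=> [dh Dh]; split=> [x Ux|v].
  apply: (@differentiable_comp _ _ _ _ h (fun y : 'rV_m => y 0 j)).
    exact: dh.
  exact: differentiable_coord.
apply: (eq_C_k_on oU _ (IH _ (Dh v))) => x /[!inE] Ux /=.
have dc : differentiable (fun y : 'rV[R]_m => y 0 j) (h x).
  exact: differentiable_coord.
rewrite [RHS](_ : _ = 'D_v ((fun y : 'rV[R]_m => y 0 j) \o h) x)//.
rewrite deriveE; last exact: dh.
rewrite deriveE; last by apply: differentiable_comp => //; exact: dh.
by rewrite (diff_comp (dh _ Ux) dc)/= -[RHS](deriveE _ dc) derive_coord.
Qed.

(** The chain rule in coordinates is a sum of products whose factors are C^k: the partials of [f]
    composed with [h] by induction, the derivatives of [h] by hypothesis. *)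
Lemma C_k_on_comp k U V (f : 'rV[R]_m -> R) (h : 'rV[R]_n -> 'rV[R]_m) :
  open U -> (forall x, U x -> V (h x)) ->
  C_k_on k V f -> C_k_on k U h -> C_k_on k U (f \o h).
Proof.
move=> oU hUV; elim: k f => [|k IH] f.
  by move=> cf ch x Ux; apply: continuous_comp; [exact: ch|apply: cf; exact: hUV].
move=> [df Df] Ch; have [dh Dh] := Ch; split=> [x Ux|v].
  by apply: differentiable_comp; [exact: dh|apply: df; exact: hUV].
apply: (@eq_C_k_on _ _ _ k U
   (\sum_j 'D_v (fun y => h y 0 j) * ('D_(delta_mx 0 j) f \o h))) => //.
  move=> x /[!inE] Ux; rewrite derive_comp_coord; last by apply: df; exact: hUV.
    by rewrite fct_sumE.
  exact: dh.
apply: C_k_on_sum => // j; apply: C_k_onM => //.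
  by have /(C_k_on_coord j oU)[_] := Ch; exact.
by apply: IH; [exact: Df|exact: C_k_onW].
Qed.

End smooth_composition.
(** * Bump functions *)

Section flat_function.
Context {R : realType}.
Implicit Types (P : {poly R}) (t s : R).

(* F is the sequence of the successive derivatives of F 0. *)
Lemma C_k_on_comp_tower {n} k U (F : nat -> R -> R) (m : nat)
    (g : 'rV[R]_n -> R) : open U ->
  (forall i t, is_derive t 1 (F i) (F i.+1 t)) ->
  C_k_on k U g -> C_k_on k U (F m \o g).
Proof.
move=> oU dF.
have dfF i t : differentiable (F i) t.
  by apply/derivable1_diffP; have [] := dF i t.
elim: k m => [|k IH] m.
  move=> cg x Ux; apply: continuous_comp; first exact: cg.
  exact/differentiable_continuous.
move=> Cg; have [dg Dg] := Cg; split=> [x Ux|v].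
  by apply: differentiable_comp => //; exact: dg.
apply: (@eq_C_k_on _ _ _ k U ('D_v g * (F m.+1 \o g))) => //.
  move=> x /[!inE] Ux; have dgx := dg _ Ux.
  rewrite [RHS]deriveE; last exact: differentiable_comp.
  rewrite (diff_comp dgx (dfF m _))/= -(deriveE _ dgx).
  rewrite diff1E//= derive1E.
  by have [_ ->] := dF m (g x).
by apply: C_k_onM; [|exact: Dg|apply: IH; exact: C_k_onW].
Qed.

(* The functions P(1/t) exp(-1/t), extended by 0 to t <= 0, are closed under
   differentiation. *)
Definition flat P t : R := if 0 < t then P.[t^-1] * expR (- t^-1) else 0.

Lemma poly_bound P : exists C : R, exists m : nat, 0 <= C /\
  forall s, 1 <= s -> `|P.[s]| <= C * s ^+ m.
Proof.
elim/poly_ind: P => [|P c [C [m [C0 hC]]]].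
  by exists 0, 0%N; split=> // s _; rewrite horner0 normr0 mul0r.
exists (C + `|c|), m.+1; split; first by rewrite addr_ge0.
move=> s s1; have s0 : 0 <= s by apply: le_trans s1.
rewrite hornerMXaddC (le_trans (ler_normD _ _))// mulrDl lerD//.
  by rewrite normrM (ger0_norm s0) exprSr mulrA ler_wpM2r// hC.
by rewrite ler_peMr// exprn_ege1.
Qed.

(** Take the power m+1 of exp(s/(m+1)) >= s/(m+1) and invert. The exponent exceeds [m] by one so as
    to beat a polynomial bound of degree [m] with a factor 1/s to spare. *)
Lemma expRN_bound m s : 0 < s ->
  expR (- s) <= (m.+1%:R / s) ^+ m.+1.
Proof.
move=> s0; rewrite expRN -[_ / s]invf_div exprVn lef_pV2 ?posrE ?expR_gt0//.
  rewrite (_ : expR s = expR (s / m.+1%:R) ^+ m.+1).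
    rewrite lerXn2r ?nnegrE ?expR_ge0//; first by rewrite divr_ge0// ltW.
    by apply: le_trans (expR_ge1Dx _); rewrite lerDr.
  by rewrite -expRM_natl mulrCA divff ?mulr1.
by rewrite exprn_gt0// divr_gt0.
Qed.

(** With s = 1/t >= 1, the bounds C s^m and ((m+1)/s)^(m+1) multiply to a constant times t. *)
Lemma flat_bound P : exists2 C : R, 0 <= C &
  forall t, t <= 1 -> `|flat P t| <= C * `|t|.
Proof.
have [C [m [C0 hC]]] := poly_bound P.
exists (C * m.+1%:R ^+ m.+1); first by rewrite mulr_ge0// exprn_ge0.
move=> t t1; rewrite /flat; case: ifPn => t0; last first.
  by rewrite normr0 !mulr_ge0// exprn_ge0.
have s1 : 1 <= t^-1 by rewrite invf_ge1.
have s0 : 0 < t^-1 by rewrite invr_gt0.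
rewrite normrM (ger0_norm (expR_ge0 _)) (gtr0_norm t0).
apply: (le_trans (ler_pM _ _ (hC _ s1) (expRN_bound m s0))); rewrite ?expR_ge0//.
rewrite invrK exprMn [t ^+ m.+1]exprSr exprVn.
rewrite le_eqVlt; apply/orP; left; apply/eqP; field.
by rewrite expf_neq0 ?gt_eqF.
Qed.

Lemma flat_derive P t :
  is_derive t 1 (flat P) (flat ('X^2 * (P - P^`())) t).
Proof.
have [t0|t0|->] := ltgtP t 0.
- rewrite {2}/flat (lt_gtF t0).
  apply: (@near_eq_is_derive _ _ _ (cst 0)) => //; near=> s.
    by rewrite /flat ifF//; apply/lt_gtF; near: s; exact: lt_nbhsl.
- rewrite {2}/flat t0.
  have tn0 : t != 0 by rewrite gt_eqF.
  pose e := fun s : R => P.[s^-1] * expR (- s^-1).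
  apply: (@near_eq_is_derive _ _ _ e) => //.
    near=> s; rewrite /flat ifT//; near: s; exact: lt_nbhsr.
  have dV : is_derive t 1 (fun s : R => s^-1) (- (t ^- 2)).
    apply: DeriveDef; first by apply: derivableV => //; exact: derivable_id.
    by rewrite deriveV// derive_id scaler1.
  have d1 : is_derive t 1 (fun s : R => P.[s^-1]) (P^`().[t^-1] * - (t ^- 2)).
    exact: (is_derive1_comp (is_derive_poly P t^-1) dV).
  have d2 : is_derive t 1 (fun s : R => expR (- s^-1)) (expR (- t^-1) * (t ^- 2)).
    rewrite -[t ^- 2]opprK.
    exact: (@is_derive1_comp _ expR (- (fun s : R => s^-1)) _ _ _
      (is_derive_expR (- t^-1)) (is_deriveN dV)).
  rewrite /e; apply: is_derive_eq; rewrite /= !hornerE.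
  rewrite /GRing.scale/= -exprVn; ring.
- rewrite {2}/flat ltxx.
  suff cv : (fun h : R => h^-1 *: ((flat P \o shift 0) (h *: 1) - flat P 0))
     @ 0^' --> (0 : R).
    by apply: DeriveDef; [apply/cvg_ex; exists 0|exact/cvg_lim].
  (* At 0 the difference quotient of [flat P] is [flat ('X * P)], which is O(|h|); the derivative
     there is thus 0. *)
  have [C C0 hC] := flat_bound ('X * P).
  have flat_quotient h : h != 0 ->
      h^-1 *: (flat P (h *: 1) - flat P 0) = flat ('X * P) h.
    rewrite /flat ltxx subr0 [h *: 1]mulr1 => h0.
    case: ifPn => _; last exact: scaler0.
    by rewrite hornerM hornerX -mulrA.
  (* [C] may be 0; C + 1 can safely be divided by. *)
  have C1 : 0 < C + 1 by rewrite ltr_wpDl.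
  apply/cvgr0Pnorm_le => e e0; have eC : 0 < e / (C + 1) by exact: divr_gt0.
  near=> h.
  have h0 : h != 0 by near: h; exact: nbhs_dnbhs_neq.
  rewrite /= addr0 flat_quotient//.
  apply: le_trans (hC _ _) _.
    by near: h; apply: cvg_within; apply: lt_le_nbhsl.
  apply: (@le_trans _ _ ((C + 1) * `|h|)); first by rewrite ler_wpM2r// lerDl.
  by rewrite -ler_pdivlMl// mulrC; near: h; exact: dnbhs0_le.
Unshelve. all: by end_near. Qed.

(** The successive derivatives of exp(-1/t), extended by 0 to t <= 0. *)
Definition flat_tower i := flat (iter i (fun P => 'X^2 * (P - P^`())) 1).

Lemma flat_towerP i t : is_derive t 1 (flat_tower i) (flat_tower i.+1 t).
Proof. exact: flat_derive. Qed.

Lemma flat_tower0 t : flat_tower 0 t = if 0 < t then expR (- t^-1) else 0.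
Proof. by rewrite /flat_tower /flat /= hornerC mul1r. Qed.

Lemma smooth_on_flat {n} U (g : 'rV[R]_n -> R) : open U ->
  smooth_on U g -> smooth_on U (flat_tower 0 \o g).
Proof. by move=> oU Cg k; apply: C_k_on_comp_tower => //; exact: flat_towerP. Qed.

End flat_function.

(** * Smooth steps and bumps on R^n *)

Section bump.
Context {R : realType} {n : nat}.
Implicit Types (U : set 'rV[R]_n) (x y : 'rV[R]_n).

Definition smooth_step (t : R) := flat_tower 0 t / (flat_tower 0 t + flat_tower 0 (1 - t)).

Lemma smooth_step_den_gt0 (t : R) : 0 < flat_tower 0 t + flat_tower 0 (1 - t).
Proof.
have f0 (s : R) : 0 <= flat_tower 0 s.
  by rewrite flat_tower0; case: ifP => // _; exact: expR_ge0.
have [t0|t0] := ltP 0 t.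
  by apply: ltr_wpDr => //; rewrite flat_tower0 t0 expR_gt0.
apply: ltr_wpDl => //; rewrite flat_tower0 ifT ?expR_gt0//.
by rewrite subr_gt0 (le_lt_trans t0).
Qed.

Lemma smooth_step_le0 (t : R) : t <= 0 -> smooth_step t = 0.
Proof. by move=> t0; rewrite /smooth_step flat_tower0 ltNge t0 mul0r. Qed.

Lemma smooth_step_ge1 (t : R) : 1 <= t -> smooth_step t = 1.
Proof.
move=> t1; have f0 : flat_tower 0 (1 - t) = 0.
  by rewrite flat_tower0 subr_gt0 ltNge t1.
have := smooth_step_den_gt0 t; rewrite /smooth_step f0 addr0 => ?.
by rewrite divff// gt_eqF.
Qed.

Lemma smooth_on_smooth_step U (g : 'rV[R]_n -> R) : open U ->
  smooth_on U g -> smooth_on U (smooth_step \o g).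
Proof.
move=> oU Cg; apply: smooth_onM => //; first exact: smooth_on_flat.
move=> k; apply: C_k_onV => //; first by move=> x _; rewrite gt_eqF// smooth_step_den_gt0.
apply: C_k_onD => //; first exact: smooth_on_flat.
apply: (@smooth_on_flat _ _ _ (fun x => 1 - g x)) => //.
by apply: (@smooth_onB _ _ _ (cst 1)) => // l; exact: C_k_on_cst.
Qed.

(** A sum of squares is used because the norm of row vectors is the maximum norm, which is not
    smooth. *)
Definition scaled_sqdist x (r : R) y : R := \sum_i ((y 0 i - x 0 i) / r) ^+ 2.

Lemma smooth_on_scaled_sqdist x r U : open U -> smooth_on U (scaled_sqdist x r).
Proof.
move=> oU; rewrite (_ : scaled_sqdist x r =
    \sum_i (fun y : 'rV_n => ((y 0 i - x 0 i) / r) ^+ 2)); last first.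
  by apply/funext => y; rewrite fct_sumE.
move=> k; apply: C_k_on_sum => // i.
pose h := fun y : 'rV[R]_n => (y 0 i - x 0 i) / r.
have Ch : C_k_on k U h.
  apply: (@C_k_onM _ _ _ _ (fun y => y 0 i - x 0 i) (cst r^-1)) => //.
    apply: (@C_k_onB _ _ _ _ _ (fun y => y 0 i) (cst (x 0 i))) => //.
      exact: smooth_on_coord.
    exact: C_k_on_cst.
  exact: C_k_on_cst.
exact: (C_k_onM oU Ch Ch).
Qed.

Definition rV_bump x (r : R) y : R := smooth_step (2 - scaled_sqdist x r y).

Lemma smooth_on_rV_bump x r U : open U -> smooth_on U (rV_bump x r).
Proof.
move=> oU; apply: (@smooth_on_smooth_step _ (fun y => _ - _)) => //.
apply: (@smooth_onB _ _ _ (cst 2)) => // [l|]; first exact: C_k_on_cst.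
exact: smooth_on_scaled_sqdist.
Qed.

Lemma rV_bump1 x r : 0 < r -> \forall y \near x, rV_bump x r y = 1.
Proof.
move=> r0; have /(_ x I) cq := @smooth_on_scaled_sqdist x r setT openT 0%N.
have q0 : scaled_sqdist x r x = 0.
  by rewrite /scaled_sqdist big1// => i _; rewrite subrr mul0r expr0n.
have : \forall y \near x, scaled_sqdist x r y < 1.
  by apply: (cvgr_lt _ cq); rewrite q0.
apply: filterS => y y1; rewrite /rV_bump smooth_step_ge1//; lra.
Qed.

(** A coordinate farther than 2r makes the squared distance exceed 4, while the bump is already zero
    from 2 on. *)
Lemma rV_bump_neq0 x r y : 0 < r -> rV_bump x r y != 0 ->
  forall i, `|y 0 i - x 0 i| <= 2 * r.
Proof.
move=> r0; apply: contra_neqP => /existsNP[i /negP]; rewrite -ltNge => ri.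
rewrite /rV_bump smooth_step_le0// subr_le0 /scaled_sqdist (bigD1 i)//=.
apply: (@le_trans _ _ (((y 0 i - x 0 i) / r) ^+ 2)); last first.
  by rewrite lerDl sumr_ge0// => j _; exact: sqr_ge0.
rewrite -[leRHS]ger0_norm ?sqr_ge0// normrX normrM normfV (gtr0_norm r0).
have : 2 <= `|y 0 i - x 0 i| / r by rewrite ler_pdivlMr// ltW.
by move: (_ / _) => z z2; nra.
Qed.

End bump.
(** * Hadamard's lemma *)

Section unit_interval_integral.
Context {R : realType}.
Implicit Types (u v : R -> R).
Local Notation I01 := (`[0%R, 1%R]%classic : set R).
Local Notation integral01 u := (\int[lebesgue_measure]_(t in I01) u t).

Lemma continuous01_integrable u : {in I01, continuous u} ->
  lebesgue_measure.-integrable I01 (EFin \o u).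
Proof.
move=> cu; apply: continuous_compact_integrable; first exact: segment_compact.
exact: continuous_in_subspaceT.
Qed.

Lemma le_integral01B u v e :
  {in I01, continuous u} -> {in I01, continuous v} ->
  (forall t, t \in I01 -> `|u t - v t| <= e) ->
  `|integral01 u - integral01 v| <= e.
Proof.
move=> cu cv uv.
have iu := continuous01_integrable cu; have iv := continuous01_integrable cv.
rewrite -RintegralB//.
have cuv : {in I01, continuous (fun t => u t - v t)}.
  by move=> t t01; apply: continuousB; [exact: cu|exact: cv].
have iuv := continuous01_integrable cuv.
apply: le_trans (le_normr_Rintegral _ iuv) _ => //.
(* The interval has measure one, so [e] is the integral of the constant [e]. *)
rewrite (_ : e = \int[lebesgue_measure]_(_ in I01) e).
  apply: le_Rintegral => //.
  - by apply: continuous01_integrable => t t01; apply: cvg_norm;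
      exact: cuv.
  - by apply: continuous01_integrable => t _; exact: cst_continuous.
  - by move=> t t01; apply: uv; rewrite inE.
rewrite Rintegral_cst//= lebesgue_measure_itv/= lte_fin ltr01.
by rewrite sube0 /= mulr1.
Qed.

Lemma integral01D u v : {in I01, continuous u} -> {in I01, continuous v} ->
  integral01 (fun t => u t + v t) = integral01 u + integral01 v.
Proof. by move=> cu cv; rewrite RintegralD//; exact: continuous01_integrable. Qed.

Lemma integral01_sum m (c : 'I_m -> R) (F : 'I_m -> R -> R) :
  (forall i, {in I01, continuous (F i)}) ->
  integral01 (fun t => \sum_i c i * F i t) = \sum_i c i * integral01 (F i).
Proof.
elim: m c F => [|m IH] c F cF.
  rewrite big_ord0 (_ : (fun t => _) = cst 0).
    by rewrite Rintegral_cst// mul0r.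
  by apply/funext => t; rewrite big_ord0.
rewrite big_ord_recl -IH//.
have cS : {in I01, continuous
    (fun t => \sum_(i < m) c (lift ord0 i) * F (lift ord0 i) t)}.
  move=> t t01; apply: (@cvg_big _ _ +%R) => [|i _]; first exact: add_continuous.
  by apply: cvgMl_tmp; exact: cF.
rewrite -RintegralZl//; last exact/continuous01_integrable/cF.
rewrite -integral01D//; last by move=> t t01; apply: cvgMl_tmp; exact: cF.
by congr Rintegral; apply/funext => t; rewrite big_ord_recl.
Qed.

Lemma integral01_FTC F u : (forall t, t \in I01 -> is_derive t 1 F (u t)) ->
  {in I01, continuous u} -> integral01 u = F 1 - F 0.
Proof.
move=> dF cu.
have cF t : t \in I01 -> {for t, continuous F}.
  move=> t01; apply/differentiable_continuous/derivable1_diffP.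
  by have [] := dF _ t01.
rewrite /Rintegral (@continuous_FTC2 _ u F)//.
- exact: continuous_in_subspaceT.
- split.
  + move=> t /subset_itv_oo_cc t01; have : t \in I01 by rewrite inE.
    by move/dF => [].
  + by apply: cvg_at_right_filter; apply: cF; rewrite inE/= in_itv/= lexx ler01.
  + by apply: cvg_at_left_filter; apply: cF; rewrite inE/= in_itv/= lexx ler01.
- move=> t /subset_itv_oo_cc t01; have : t \in I01 by rewrite inE.
  by move/dF => [_ <-]; rewrite derive1E.
Qed.

End unit_interval_integral.

(** * Differentiation under the integral along segments *)

Section hadamard.
Context {R : realType} {n : nat}.
Local Notation I01 := (`[0%R, 1%R]%classic : set R).
Local Notation integral01 u := (\int[lebesgue_measure]_(t in I01) u t).
Implicit Types (U : set 'rV[R]_n) (f h : 'rV[R]_n -> R) (x y z w : 'rV[R]_n).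

Lemma ler_coord_norm (y : 'rV[R]_n) j : `|y 0 j| <= `|y|.
Proof.
rewrite [leRHS]mx_normrE.
exact: (le_bigmax _ (fun i : 'I_1 * 'I_n => `|y i.1 i.2|) (0, j)).
Qed.

Lemma is_derive_line f z w (s : R) : differentiable f (z + s *: w) ->
  is_derive s 1 (fun t : R => f (z + t *: w)) ('D_w f (z + s *: w)).
Proof.
move=> df; pose g : R -> 'rV[R]_n := cst z + *:%R^~ w.
have dg : is_diff s g (0 + ( *:%R^~ w)) by apply: is_diffD.
have [dg' dgE] := dg.
have dfg : differentiable (f \o g) s by exact: differentiable_comp.
apply: DeriveDef; first exact: diff_derivable dfg.
rewrite [LHS](deriveE (1 : R^o) dfg) (diff_comp dg' df)/= dgE deriveE//=.
by rewrite fctE add0r scale1r.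
Qed.

(** Compactness of [0, 1], in its near-covering form, makes the neighbourhood of [w] uniform in
    [t]. *)
Lemma uniform_continuity_segment f (g : R -> 'rV[R]_n) (e : R) : 0 < e ->
  {in I01, continuous g} -> (forall t, t \in I01 -> {for g t, continuous f}) ->
  \forall w \near (0 : 'rV[R]_n),
    forall t, t \in I01 -> `|f (g t + w) - f (g t)| <= e.
Proof.
move=> e0 cg cf.
have /compact_near_coveringP/(_ _ (nbhs (0 : 'rV[R]_n))
   (fun w t => `|f (g t + w) - f (g t)| <= e)) := @segment_compact R 0 1.
move=> H; have {}H := H _ _; suff : \forall w \near (0 : 'rV[R]_n),
    (I01 `<=` (fun t : R => `|f (g t + w) - f (g t)| <= e)).
  by apply: filterS => w hw t t01; apply: hw; rewrite inE in t01.
apply: H => t t01; have {}t01 : t \in I01 by rewrite inE.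
have e2 : 0 < e / 2 by rewrite divr_gt0.
have ft : \forall z \near g t, `|f (g t) - f z| < e / 2.
  by have /cvgrPdist_lt := cf _ t01; apply.
have c1 : (fun p : R * 'rV[R]_n => g p.1 + p.2) @ (nbhs t, nbhs (0 : 'rV[R]_n)) --> g t.
  rewrite -[X in _ --> X]addr0; apply: cvgD; last exact: cvg_snd.
  apply: (@cvg_comp _ _ _ fst g _ (nbhs t)); [exact: cvg_fst|exact: cg].
have c2 : (fun p : R * 'rV[R]_n => g p.1) @ (nbhs t, nbhs (0 : 'rV[R]_n)) --> g t.
  apply: (@cvg_comp _ _ _ fst g _ (nbhs t)); [exact: cvg_fst|exact: cg].
have /c1 n1 := ft; have /c2 n2 := ft.
near=> p => /=.
(* Both values are compared with [f (g t)], each within e/2. *)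
have -> : f (g p.1 + p.2) - f (g p.1) =
  (f (g t) - f (g p.1)) - (f (g t) - f (g p.1 + p.2)) by ring.
rewrite (le_trans (ler_normB _ _))// (splitr e) lerD// ltW//.
  by near: p.
by near: p.
Unshelve. all: by end_near. Qed.

(** The mean value theorem turns the increment into a derivative along [w] at some point of the
    segment; each of the [n] partials there is off by at most [e]. *)
Lemma derive_sum_bound f z w (e : R) U : smooth_on U f ->
  (forall s : R, s \in I01 -> U (z + s *: w)) ->
  (forall j (s : R), s \in I01 ->
    `|'D_(delta_mx 0 j) f (z + s *: w) - 'D_(delta_mx 0 j) f z| <= e) ->
  `|f (z + w) - f z - \sum_j w 0 j * 'D_(delta_mx 0 j) f z| <= n%:R * `|w| * e.
Proof.
move=> Cf zU de.
have df s : s \in I01 -> differentiable f (z + s *: w).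
  by move=> /zU; exact: smooth_on_differentiable.
have [|||s s01] := @MVT_segment R (fun t => f (z + t *: w))
   (fun s => 'D_w f (z + s *: w)) 0 1.
- exact: ler01.
- move=> s /subset_itv_oo_cc s01; apply: is_derive_line; apply: df.
  by rewrite inE.
- apply: continuous_in_subspaceT => s /df /is_derive_line[d _].
  exact/differentiable_continuous/derivable1_diffP.
rewrite scale0r scale1r addr0 subr0 mulr1 => ->.
have {}s01 : s \in I01 by rewrite inE.
rewrite derive_sum_basis; last exact: df.
rewrite -sumrB -mulrA mulr_natl.
have -> : `|w| * e *+ n = \sum_(j < n) `|w| * e by rewrite sumr_const card_ord.
apply: le_trans (ler_norm_sum _ _ _) _; apply: ler_sum => j _.
by rewrite -mulrBr normrM ler_pM ?ler_coord_norm ?de.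
Qed.

(** Differentiating in [y] under the integral brings out a factor t; the weight t^m makes the family
    stable under this operation. *)
Definition segment_mean x (m : nat) h y : R :=
  integral01 (fun t : R => t ^+ m * h (x + t *: (y - x))).

Definition star_shaped U x := forall y (t : R), U y -> t \in I01 -> U (x + t *: (y - x)).

Lemma continuous_segment x y (m : nat) h : 
  (forall t, t \in I01 -> {for x + t *: (y - x), continuous h}) ->
  {in I01, continuous (fun t : R => t ^+ m * h (x + t *: (y - x)))}.
Proof.
move=> ch t t01; apply: cvgM; first exact: exprn_continuous.
apply: (@continuous_comp _ _ _ (fun t : R => x + t *: (y - x)) h); last exact: ch.
by apply: cvgD; [exact: cvg_cst|apply: cvgZr_tmp; exact: cvg_id].
Qed.

Lemma segment_mean_estimate U x y m h e : open U -> star_shaped U x ->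
  smooth_on U h -> U y -> 0 < e ->
  \forall u \near (0 : 'rV[R]_n),
   `|segment_mean x m h (y + u) - segment_mean x m h y -
     \sum_j u 0 j * segment_mean x m.+1 ('D_(delta_mx 0 j) h) y| <= e * `|u|.
Proof.
move=> oU sU Ch Uy e0.
have ch z : U z -> {for z, continuous h} by apply: (Ch 0%N).
have cDh j z : U z -> {for z, continuous ('D_(delta_mx 0 j) h)}.
  by apply: (smooth_on_derive _ Ch 0%N).
(* Summing over [n] coordinates costs a factor [n]; n + 1 is positive even when [n] is 0. *)
set e' := e / n.+1%:R.
have e'0 : 0 < e' by rewrite divr_gt0.
have cg : {in I01, continuous (fun t : R => x + t *: (y - x))}.
  by move=> t t01; apply: cvgD; [exact: cvg_cst|apply: cvgZr_tmp; exact: cvg_id].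
have unifD j : \forall w \near (0 : 'rV[R]_n), forall t, t \in I01 ->
    `|'D_(delta_mx 0 j) h (x + t *: (y - x) + w) -
      'D_(delta_mx 0 j) h (x + t *: (y - x))| <= e'.
  apply: (@uniform_continuity_segment ('D_(delta_mx 0 j) h) _ _ e'0 cg) => t t01.
  by apply: cDh; exact: sU.
have /nbhs_ballP[d /= d0 dD] := filter_forall (nbhs_filter _) unifD.
have [d' /= d'0 d'U] : exists2 d' : R, 0 < d' & ball y d' `<=` U.
  by apply/nbhs_ballP; exact: open_nbhs_nbhs.
near=> u.
have ud : `|u| < d.
  have : ball 0 d u by near: u; exact: nbhsx_ballx.
  by rewrite -ball_normE/= sub0r normrN.
have ud' : `|u| < d'.
  have : ball 0 d' u by near: u; exact: nbhsx_ballx.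
  by rewrite -ball_normE/= sub0r normrN.
have norm01 (s : R) (w : 'rV[R]_n) : s \in I01 -> `|s *: w| <= `|w|.
  rewrite inE/= in_itv/= => /andP[s0 s1].
  by rewrite normrZ ger0_norm// ler_piMl.
have uU s : s \in I01 -> U (y + s *: u).
  move=> s01; apply: d'U; rewrite -ball_normE/= opprD addNKr normrN.
  exact: le_lt_trans (norm01 _ _ s01) ud'.
have Uyu : U (y + u).
  by rewrite -[u]scale1r; apply: uU; rewrite inE/= in_itv/= lexx ler01.
have cm k (k' : nat) v : U v -> (forall z, U z -> {for z, continuous k}) ->
    {in I01, continuous (fun t : R => t ^+ k' * k (x + t *: (v - x)))}.
  by move=> Uv ck; apply: continuous_segment => t t01; apply: ck; exact: sU.
have cs : {in I01, continuous (fun t : R => \sum_j u 0 j *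
    (t ^+ m.+1 * 'D_(delta_mx 0 j) h (x + t *: (y - x))))}.
  move=> t t01; apply: (@cvg_big _ _ +%R) => [|j _]; first exact: add_continuous.
  by apply: cvgMl_tmp; apply: (cm ('D_(delta_mx 0 j) h)) => // z; exact: cDh.
rewrite /segment_mean -integral01_sum; last first.
  by move=> j; apply: (cm ('D_(delta_mx 0 j) h)) => // z; exact: cDh.
rewrite -addrA -opprD -integral01D//; last exact: cm.
apply: le_integral01B; first exact: cm.
  by move=> t t01; apply: cvgD; [exact: (cm h)|exact: cs].
move=> t t01; set z := x + t *: (y - x).
have -> : x + t *: (y + u - x) = z + t *: u by rewrite /z addrAC scalerDr addrA.
(* Moving [y] by [u] moves the point [z] of the segment by t u: one factor of t^(m+1) goes into this
   displacement. *)
have -> : \sum_j u 0 j * (t ^+ m.+1 * 'D_(delta_mx 0 j) h z) =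
    t ^+ m * \sum_j (t *: u) 0 j * 'D_(delta_mx 0 j) h z.
  by rewrite mulr_sumr; apply: eq_bigr => j _; rewrite mxE exprS; ring.
rewrite opprD addrA -!mulrBr normrM.
have tm : `|t ^+ m| <= 1.
  move: t01; rewrite inE/= in_itv/= => /andP[t0 t1].
  by rewrite normrX ger0_norm// exprn_ile1.
apply: le_trans (ler_wpM2r _ tm) _; rewrite // mul1r.
apply: (@le_trans _ _ (n%:R * `|t *: u| * e')).
  apply: (derive_sum_bound Ch).
    move=> s s01; have -> : z + s *: (t *: u) = x + t *: (y + s *: u - x).
      by rewrite /z scalerA mulrC -scalerA -addrA -scalerDr addrAC.
    by apply: sU => //; exact: uU.
  move=> j s s01; apply: dD => //; rewrite -ball_normE/= sub0r normrN.
  exact: le_lt_trans (norm01 _ _ s01) (le_lt_trans (norm01 _ _ t01) ud).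
apply: (@le_trans _ _ (n.+1%:R * `|u| * e')); last first.
  by rewrite /e' mulrC mulrA divfK// pnatr_eq0.
apply: ler_wpM2r; first exact: ltW.
by apply: ler_pM; rewrite ?ler_nat ?norm01.
Unshelve. all: by end_near. Qed.

Lemma segment_mean_diff U x y m h : open U -> star_shaped U x ->
  smooth_on U h -> U y -> differentiable (segment_mean x m h) y /\
  forall v, 'D_v (segment_mean x m h) y =
    \sum_j v 0 j * segment_mean x m.+1 ('D_(delta_mx 0 j) h) y.
Proof.
move=> oU sU Ch Uy.
pose L (u : 'rV[R]_n) : R := \sum_j u 0 j * segment_mean x m.+1 ('D_(delta_mx 0 j) h) y.
have Ll : linear (L : 'rV[R]_n -> R^o).
  move=> a u v; rewrite /L scaler_sumr -big_split/=; apply: eq_bigr => j _.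
  by rewrite !mxE mulrDl /GRing.scale/= mulrA.
pose Ll' : {linear 'rV[R]_n -> R^o} := HB.pack L (GRing.isLinear.Build _ _ _ _ L Ll).
have cL : continuous L.
  apply: (@continuous_big _ _ +%R) => [|j _]; first exact: add_continuous.
  by move=> u; exact: (@cvgM _ _ (nbhs u) _ (fun u : 'rV[R]_n => u 0 j)
    (cst _) _ _ (@coord_continuous R 1 n 0 j u) (cvg_cst _)).
(* The estimate says that the continuous linear map [L] approximates the increment to first order;
   uniqueness identifies it with the differential. *)
have diffE := @diff_unique R _ R (segment_mean x m h) Ll' y (cL : continuous Ll').
have E : segment_mean x m h \o shift y =
    cst (segment_mean x m h y) + (Ll' : _ -> R) +o_ (0 : 'rV[R]_n) id.
  apply/eqaddoP => e e0.
  apply: filterS (segment_mean_estimate m oU sU Ch Uy e0) => u.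
  by rewrite -addrA -opprD [y + u]addrC.
have dE : 'd (segment_mean x m h) y = L :> (_ -> _) := diffE E.
have df : differentiable (segment_mean x m h) y.
  by apply/diff_locallyP; rewrite dE; split.
by split=> // v; rewrite deriveE// dE.
Qed.

Lemma smooth_on_segment_mean U x m h : open U -> star_shaped U x ->
  smooth_on U h -> smooth_on U (segment_mean x m h).
Proof.
move=> oU sU Ch k; elim: k m h Ch => [|k IH] m h Ch.
  move=> y Uy; apply: differentiable_continuous.
  by have [] := segment_mean_diff m oU sU Ch Uy.
split=> [y Uy|v]; first by have [] := segment_mean_diff m oU sU Ch Uy.
apply: (@eq_C_k_on _ _ _ k U
   (\sum_j cst (v 0 j) * segment_mean x m.+1 ('D_(delta_mx 0 j) h))) => //.
  move=> y /[!inE] Uy; have [_ ->] := segment_mean_diff m oU sU Ch Uy.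
  by rewrite fct_sumE.
apply: C_k_on_sum => // j; apply: C_k_onM => //; first exact: C_k_on_cst.
by apply: IH; exact: smooth_on_derive.
Qed.

(** The fundamental theorem of calculus for t |-> f (x + t (y - x)), whose derivative expands in the
    partials of [f]. *)
Lemma hadamard U x f y : open U -> star_shaped U x -> smooth_on U f -> U y ->
  f y = f x + \sum_j (y 0 j - x 0 j) * segment_mean x 0 ('D_(delta_mx 0 j) f) y.
Proof.
move=> oU sU Cf Uy.
have Uz t : t \in I01 -> U (x + t *: (y - x)) by move=> t01; exact: sU.
have df t : t \in I01 -> differentiable f (x + t *: (y - x)).
  by move=> /Uz; exact: smooth_on_differentiable.
have cD j : {in I01, continuous
    (fun t : R => t ^+ 0 * 'D_(delta_mx 0 j) f (x + t *: (y - x)))}.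
  apply: (@continuous_segment _ _ _ ('D_(delta_mx 0 j) f)) => t /Uz.
  exact: (smooth_on_derive _ Cf 0%N).
rewrite -integral01_sum//.
pose F t := f (x + t *: (y - x)).
have -> : f y = f x + (F 1 - F 0).
  by rewrite /F scale1r scale0r addr0 addrC !subrK addrC subrK.
congr (_ + _); apply/esym; apply: integral01_FTC.
  move=> t t01; apply: is_derive_eq; first by apply: is_derive_line; exact: df.
  rewrite derive_sum_basis; last exact: df.
  by apply: eq_bigr => j _; rewrite !mxE expr0 mul1r.
move=> t t01; apply: (@cvg_big _ _ +%R) => [|j _]; first exact: add_continuous.
by apply: cvgMl_tmp; exact: cD.
Qed.

Lemma segment_mean0 x h : segment_mean x 0 h x = h x.
Proof.
rewrite /segment_mean (_ : (fun t => _) = cst (h x)).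
  rewrite Rintegral_cst//= lebesgue_measure_itv/= lte_fin ltr01.
  by rewrite sube0 /= mulr1.
by apply/funext => t; rewrite expr0 mul1r subrr scaler0 addr0.
Qed.

End hadamard.
(** * Smooth functions on a manifold *)

Section manifold_charts.
Context {R : realType} {n : nat} (M : smooth_manifold R n).
Implicit Types (c : chart R n M) (p q : M) (W : set M).

Lemma chart_continuous c p : atlas c -> chart_dom c p ->
  {for p, continuous (chart_fun c)}.
Proof.
move=> /atlas_homeo[oD _ _ + _] cp.
by rewrite continuous_open_subspace// => /(_ p); apply; rewrite inE.
Qed.

Lemma chart_inv_continuous c y : atlas c -> chart_cod c y ->
  {for y, continuous (chart_inv c)}.
Proof.
move=> /atlas_homeo[_ oC _ _ +] cy.
by rewrite continuous_open_subspace// => /(_ y); apply; rewrite inE.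
Qed.

Lemma chart_funK c p : atlas c -> chart_dom c p -> chart_inv c (chart_fun c p) = p.
Proof. by move=> /atlas_homeo[_ _ + _ _]; exact. Qed.

Lemma chart_cod_fun c p : chart_dom c p -> chart_cod c (chart_fun c p).
Proof. by move=> cp; exists p. Qed.

Lemma chart_invK c y : atlas c -> chart_cod c y -> chart_fun c (chart_inv c y) = y.
Proof. by move=> ac [p cp <-]; rewrite chart_funK. Qed.

Lemma chart_dom_inv c y : atlas c -> chart_cod c y -> chart_dom c (chart_inv c y).
Proof. by move=> ac [p cp <-]; rewrite chart_funK. Qed.

Lemma open_chart_image c W : atlas c -> open W -> W `<=` chart_dom c ->
  open (chart_fun c @` W).
Proof.
move=> ac oW Wc; have [_ oC _ _ _] := atlas_homeo ac.
rewrite openE => _ [p Wp <-]; have cp := Wc _ Wp.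
have cy := chart_cod_fun cp.
have Wn : \forall y \near chart_fun c p, W (chart_inv c y).
  apply: (chart_inv_continuous ac cy).
  by rewrite chart_funK//; exact: open_nbhs_nbhs.
have Cn : \forall y \near chart_fun c p, chart_cod c y by exact: open_nbhs_nbhs.
near=> y; exists (chart_inv c y); first by near: y.
by apply: chart_invK => //; near: y.
Unshelve. all: by end_near. Qed.

Lemma open_chart_preimage c B : atlas c -> open B ->
  open (chart_dom c `&` chart_fun c @^-1` B).
Proof.
move=> ac oB; have [oD _ _ _ _] := atlas_homeo ac.
rewrite openE => p [cp Bp]; apply: filterI; first exact: open_nbhs_nbhs.
by apply: (chart_continuous ac cp); exact: open_nbhs_nbhs.
Qed.

(* Smoothness in one chart on a whole neighbourhood: pointwise C^k is not stable
   under change of charts for the definition of C_k_on. *)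
Definition locally_smooth (f : M -> R) p := exists c W,
  [/\ atlas c, open W, W p, W `<=` chart_dom c &
      smooth_on (chart_fun c @` W) (f \o chart_inv c)].

(** Near the image of [p], [f] read in any chart [c'] is [f] read in [c] composed with a smooth
    transition map. *)
Lemma locally_smoothP f : (forall p, locally_smooth f p) -> smooth_function f.
Proof.
move=> lf c' ac' k; apply/C_k_on_pointwise => _ [p c'p <-].
have [c [W [ac oW Wp Wc sf]]] := lf p.
have [oD' _ _ _ _] := atlas_homeo ac'.
have oW' : open (W `&` chart_dom c') by exact: openI.
have oU : open (chart_fun c' @` (W `&` chart_dom c')).
  by apply: open_chart_image.
apply: (@C_k_on_subset _ _ _ k (chart_fun c' @` (W `&` chart_dom c'))).
  by move=> _ ->; exists p.
apply: (@eq_C_k_on _ _ _ k _ ((f \o chart_inv c) \o (chart_fun c \o chart_inv c'))) => //.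
  move=> _ /[!inE] -[q [Wq c'q] <-] /=.
  by rewrite (chart_funK ac' c'q) (chart_funK ac (Wc _ Wq)).
apply: (C_k_on_comp _ _ (sf k)) => //.
  by move=> _ [q [Wq c'q] <-]; rewrite /= chart_funK//; exists q.
apply: C_k_on_subset (atlas_smooth ac' ac k) => _ [q [Wq c'q] <-].
by exists q => //; split => //; exact: Wc.
Qed.

Lemma locally_smooth_near f (g : smooth_fun M) p :
  (\near p, f p = g p) -> locally_smooth f p.
Proof.
move=> fg; have [c ac cp] := atlas_cover p.
have [oD _ _ _ _] := atlas_homeo ac.
have [W [oW Wp] Wfg] : exists2 W, open_nbhs p W & W `<=` [set q | f q = g q].
  by have : nbhs p [set q | f q = g q] by []; rewrite nbhsE.
exists c, (W `&` chart_dom c); split => //; [exact: openI|move=> k].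
have oU : open (chart_fun c @` (W `&` chart_dom c)).
  by apply: open_chart_image => //; exact: openI.
apply: (@eq_C_k_on _ _ _ k _ (g \o chart_inv c)) => //.
  by move=> _ /[!inE] -[q [Wq cq] <-] /=; rewrite chart_funK// Wfg.
case: (g) => g' /= /asboolP /(_ c ac k); apply: C_k_on_subset.
by move=> _ [q [Wq cq] <-]; exact: chart_cod_fun.
Qed.

Lemma locally_smooth_chart f c B (h : 'rV[R]_n -> R) p : atlas c -> open B ->
  chart_dom c p -> B (chart_fun c p) -> smooth_on B h ->
  (forall q, chart_dom c q -> B (chart_fun c q) -> f q = h (chart_fun c q)) ->
  locally_smooth f p.
Proof.
move=> ac oB cp Bp sh fh; exists c, (chart_dom c `&` chart_fun c @^-1` B).
have oW := open_chart_preimage ac oB.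
split => // k.
apply: (@eq_C_k_on _ _ _ k _ h); first exact: open_chart_image.
  move=> _ /[!inE] -[q [cq Bq] <-] /=; rewrite chart_funK//; exact/esym/fh.
by apply: (@C_k_on_subset _ _ _ k B) => // _ [q [cq Bq] <-].
Qed.

Lemma closed_box_compact (x : 'rV[R]_n) (r : R) :
  compact [set y : 'rV[R]_n | forall i, `|y 0 i - x 0 i| <= r].
Proof.
have -> : [set y : 'rV[R]_n | forall i, `|y 0 i - x 0 i| <= r] =
    [set y : 'rV[R]_n | forall i, `[x 0 i - r, x 0 i + r]%classic (y ord0 i)].
  by apply/seteqP; split=> y /= yx i; move: (yx i); rewrite /= in_itv/= ler_distl.
by apply: (@rV_compact _ _ (fun i => `[x 0 i - r, x 0 i + r]%classic)) => i;
  exact: segment_compact.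
Qed.

Lemma closed_box_ball (x y : 'rV[R]_n) (r s : R) : 0 < s -> r < s ->
  (forall i, `|y 0 i - x 0 i| <= r) -> ball x s y.
Proof.
move=> s0 rs yx; rewrite -ball_normE/= [ltLHS]mx_normrE.
apply/bigmax_ltP; split=> // -[i j] _ /=; rewrite ord1 !mxE distrC.
exact: le_lt_trans (yx j) rs.
Qed.

(** A bump of R^n is pulled back and extended by zero. The extension is smooth because the compact
    support box has a compact image, closed since [M] is Hausdorff. The last clause cuts off any
    smooth function on [B] to a global one. *)
Lemma chart_bump c B p : atlas c -> open B -> B `<=` chart_cod c ->
  chart_dom c p -> B (chart_fun c p) ->
  exists chi : smooth_fun M, [/\ \near p, chi p = 1,
    forall q, chi q != 0 -> chart_dom c q /\ B (chart_fun c q) &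
    forall h, smooth_on B h ->
      smooth_function (fun q => chi q * h (chart_fun c q))].
Proof.
move=> ac oB Bc cp Bp; have [oD oC _ _ ci] := atlas_homeo ac.
have [e e0 eB] : exists2 e : R, 0 < e & ball (chart_fun c p) e `<=` B.
  by apply/nbhs_ballP; exact: open_nbhs_nbhs.
(* The bump lives in a box of half-side 2r = e/2, well inside the ball of radius [e]. *)
set x := chart_fun c p; pose r := e / 4.
have r0 : 0 < r by rewrite divr_gt0.
pose b := rV_bump x r.
pose K' := [set y : 'rV[R]_n | forall i, `|y 0 i - x 0 i| <= 2 * r].
have K'B : K' `<=` B.
  move=> y yx; apply: eB; apply: (closed_box_ball e0 _ yx).
  by rewrite /r; lra.
pose K := chart_inv c @` K'.
have Kcl : closed K.
  apply: compact_closed; first exact: manifold_hausdorff.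
  apply: continuous_compact; last exact: closed_box_compact.
  by apply: continuous_subspaceW ci; exact: subset_trans Bc.
pose chi q := if `[< chart_dom c q >] then b (chart_fun c q) else 0.
have chi_neq0 q : chi q != 0 -> chart_dom c q /\ K' (chart_fun c q).
  rewrite /chi; case: asboolP => [cq|_]; last by rewrite eqxx.
  by move=> bq; split=> //; exact: (rV_bump_neq0 r0 bq).
have chiM h : smooth_on B h -> smooth_function (fun q => chi q * h (chart_fun c q)).
  move=> sh; apply: locally_smoothP => q.
  have [[cq Bq]|cBq] := pselect (chart_dom c q /\ B (chart_fun c q)).
    apply: (@locally_smooth_chart _ c B (b * h)) => //.
      by apply: smooth_onM => //; exact: smooth_on_rV_bump.
    by move=> q' cq' Bq'; rewrite /chi asboolT.
  apply: (@locally_smooth_near _ 0).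
  have : \forall q' \near q, ~ K q'.
    apply: open_nbhs_nbhs; split; first exact: closed_openC.
    move=> [y /K'B By yq]; apply: cBq; rewrite -yq.
    by split; [apply: chart_dom_inv => //; exact: Bc|rewrite chart_invK//; exact: Bc].
  apply: filterS => q' Kq'; have [->|/chi_neq0[cq' K'q']] := eqVneq (chi q') 0.
    by rewrite mul0r.
  by exfalso; apply: Kq'; exists (chart_fun c q') => //; rewrite chart_funK.
have schi : chi \in @smooth_function_pred R n M.
  apply/asboolP; rewrite (_ : chi = fun q => chi q * cst 1 (chart_fun c q)).
    by apply: chiM => k; exact: C_k_on_cst.
  by apply/funext => q; rewrite mulr1.
exists (SmoothFun schi); split=> [|q /chi_neq0[cq /K'B]|] //=.
have : \near p, b (chart_fun c p) = 1.
  exact: (chart_continuous ac cp (rV_bump1 x r0)).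
have : \near p, chart_dom c p by exact: open_nbhs_nbhs.
by apply: filterS2 => q cq; rewrite /chi asboolT.
Qed.

Lemma bump_function W p : open W -> W p -> exists chi : smooth_fun M,
  (\near p, chi p = 1) /\ forall q, chi q != 0 -> W q.
Proof.
move=> oW Wp; have [c ac cp] := atlas_cover p.
have [oD _ _ _ _] := atlas_homeo ac.
have oB : open (chart_fun c @` (W `&` chart_dom c)).
  by apply: open_chart_image => //; exact: openI.
have Bc : chart_fun c @` (W `&` chart_dom c) `<=` chart_cod c.
  by move=> _ [q [Wq cq] <-]; exact: chart_cod_fun.
have Bp : (chart_fun c @` (W `&` chart_dom c)) (chart_fun c p) by exists p.
have [chi [chi1 chiW _]] := chart_bump ac oB Bc cp Bp.
exists chi; split=> // q /chiW[cq [q' [Wq' cq'] qq']].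
by rewrite -(chart_funK ac cq) -qq' chart_funK.
Qed.

End manifold_charts.

(** * The algebra of smooth functions and its derivations *)

Section smooth_functions_theory.
Context {R : realType} {n : nat} {M : smooth_manifold R n}.
Local Notation F := (smooth_fun M).
Local Notation VF := (vector_field M).
Implicit Types (f g : F) (X Y V W Z : VF) (p q : M).

Lemma smooth_funP f : smooth_function f.
Proof. by case: f => f /= /asboolP. Qed.

Lemma smooth_fun_ext f g : (forall p, f p = g p) -> f = g.
Proof. by move=> fg; apply/val_inj/funext. Qed.

Lemma smooth_function_exists (f : M -> R) : smooth_function f ->
  exists f' : F, forall p, f' p = f p.
Proof. by move=> sf; have /asboolP H := sf; exists (SmoothFun H). Qed.

Lemma smooth_funD f g p : (f + g) p = f p + g p. Proof. by []. Qed.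
Lemma smooth_funM f g p : (f * g) p = f p * g p. Proof. by []. Qed.
Lemma smooth_funZ (a : R) f p : (a *: f) p = a * f p. Proof. by []. Qed.
Lemma smooth_funN f p : (- f) p = - f p. Proof. by []. Qed.
Lemma smooth_funB f g p : (f - g) p = f p - g p. Proof. by []. Qed.
Lemma smooth_fun0 p : (0 : F) p = 0. Proof. by []. Qed.
Lemma smooth_fun1 p : (1 : F) p = 1. Proof. by []. Qed.
Definition smooth_funE := (smooth_funD, smooth_funB, smooth_funN, smooth_funM,
  smooth_funZ, smooth_fun0, smooth_fun1).

(** Named so as to carry a ring morphism structure, through which sums and determinants are
    evaluated at [p]. *)
Definition eval_at p (f : F) : R := f p.

Fact eval_at_zmod_morphism p : zmod_morphism (eval_at p). Proof. by []. Qed.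
Fact eval_at_monoid_morphism p : monoid_morphism (eval_at p). Proof. by []. Qed.
HB.instance Definition _ p := GRing.isZmodMorphism.Build F R (eval_at p)
  (eval_at_zmod_morphism p).
HB.instance Definition _ p := GRing.isMonoidMorphism.Build F R (eval_at p)
  (eval_at_monoid_morphism p).

Lemma smooth_fun_sum m (h : 'I_m -> F) p : (\sum_i h i) p = \sum_i h i p.
Proof. exact: (raddf_sum (eval_at p)). Qed.

Lemma smooth_fun_inv f : (forall p, f p != 0) ->
  exists g, forall p, g p = (f p)^-1.
Proof.
move=> f0; apply: smooth_function_exists => c ac k.
have [_ oc _ _ _] := atlas_homeo ac.
have fc0 y : chart_cod c y -> (f \o chart_inv c) y != 0 by move=> _; exact: f0.
exact: (C_k_onV oc fc0 (smooth_funP f ac k)).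
Qed.

(* With chi a bump at p supported in {f != 0}, take f / (f^2 + (1 - chi)^2). *)
Lemma smooth_fun_local_inv f p : f p != 0 ->
  exists g, \forall q \near p, g q * f q = 1.
Proof.
move=> fpn0; have [c ac cp] := atlas_cover p.
have [W [oW Wp] Wf] : exists2 W, open_nbhs p W & W `<=` [set q | f q != 0].
  suff : nbhs p [set q | f q != 0] by rewrite nbhsE.
  have cts : {for chart_fun c p, continuous (f \o chart_inv c)}.
    by apply: (smooth_funP f ac 0%N); exact: chart_cod_fun.
  have : \forall y \near chart_fun c p, (f \o chart_inv c) y != 0.
    by apply: (cvgr_neq0 _ cts); rewrite /= chart_funK.
  move=> /(chart_continuous ac cp).
  have : \near p, chart_dom c p.
    by have [oD _ _ _ _] := atlas_homeo ac; exact: open_nbhs_nbhs.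
  by apply: filterS2 => q cq /=; rewrite chart_funK.
have [chi [chi1 chiW]] := bump_function oW Wp.
(* Where [chi] vanishes the second square is 1; elsewhere [f] is nonzero. *)
have den0 q : (f * f + (1 - chi) * (1 - chi)) q != 0.
  rewrite !smooth_funE; have [chi0|/chiW/Wf/= fq] := eqVneq (chi q) 0.
    rewrite chi0 subr0 mulr1 gt_eqF// ltr_wpDl// -expr2; exact: sqr_ge0.
  rewrite gt_eqF// ltr_wpDr// -expr2; first exact: sqr_ge0.
  by rewrite exprn_even_gt0.
have [h hE] := smooth_fun_inv den0.
exists (h * f); apply: filterS chi1 => q chi1.
rewrite !smooth_funE hE !smooth_funE chi1 subrr mul0r addr0.
have [fq|fq] := eqVneq (f q) 0.
  by have := den0 q; rewrite !smooth_funE chi1 fq subrr mul0r addr0 eqxx.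
by rewrite -mulrA mulVf// mulf_neq0.
Qed.

Lemma smooth_function_glue (f : M -> R) :
  (forall p, exists g, \forall q \near p, f q = g q) -> smooth_function f.
Proof.
move=> fg; apply: locally_smoothP => p; have [g pg] := fg p.
exact: locally_smooth_near pg.
Qed.

Lemma vector_field_ext X Y : (forall f p, X f p = Y f p) -> X = Y.
Proof.
move=> XY; apply/val_inj/funext => f; apply: smooth_fun_ext => p; exact: XY.
Qed.

Lemma vector_fieldM X f g : X (f * g) = X f * g + f * X g.
Proof. by have [_ ->] := vector_fieldP X. Qed.

Lemma vector_fieldD X f g : X (f + g) = X f + X g.
Proof.
have [Xl _] := vector_fieldP X.
by have := Xl 1 f g; rewrite !scale1r.
Qed.

Lemma vector_field0 X : X 0 = 0.
Proof. by apply: (addrI (X 0)); rewrite -vector_fieldD !addr0. Qed.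

Lemma vector_fieldZ X (a : R) f : X (a *: f) = a *: X f.
Proof.
have [Xl _] := vector_fieldP X.
by have := Xl a f 0; rewrite vector_field0 !addr0.
Qed.

Lemma vector_fieldN X f : X (- f) = - X f.
Proof. by rewrite -scaleN1r vector_fieldZ scaleN1r. Qed.

Lemma vector_fieldB X f g : X (f - g) = X f - X g.
Proof. by rewrite vector_fieldD vector_fieldN. Qed.

Lemma vector_field1 X : X 1 = 0.
Proof.
apply: (addrI (X 1)); rewrite addr0 -[in RHS](mulr1 1) vector_fieldM.
by rewrite mulr1 mul1r.
Qed.

Lemma vector_field_cst X (a : R) : X (a *: (1 : F)) = 0.
Proof. by rewrite vector_fieldZ vector_field1 scaler0. Qed.

Lemma vector_field_sum X m (h : 'I_m -> F) : X (\sum_i h i) = \sum_i X (h i).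
Proof.
apply: (big_morph X) => [f g|]; [exact: vector_fieldD|exact: vector_field0].
Qed.

Lemma add_vector_fieldE X Y f : (X + Y) f = X f + Y f. Proof. by []. Qed.
Lemma opp_vector_fieldE X f : (- X) f = - X f. Proof. by []. Qed.
Lemma scale_vector_fieldE h X f : (h *: X) f = h * X f. Proof. by []. Qed.

Lemma sum_vector_fieldE m (E : 'I_m -> VF) f :
  (\sum_i E i) f = \sum_i E i f.
Proof. by apply: (big_morph (fun X : VF => X f)). Qed.

(** With [chi] a bump supported where [f] and [g] agree, [chi * (f - g)] is 0; the Leibniz rule at
    [p] concludes. *)
Lemma vector_field_local X f g p : (\near p, f p = g p) -> X f p = X g p.
Proof.
move=> fg; have [W [oW Wp] Wfg] : exists2 W, open_nbhs p W & W `<=` [set q | f q = g q].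
  by have : nbhs p [set q | f q = g q] by []; rewrite nbhsE.
have [chi [/nbhs_singleton chi1 chiW]] := bump_function oW Wp.
have : chi * (f - g) = 0.
  apply: smooth_fun_ext => q; rewrite !smooth_funE.
  have [->|/chiW/Wfg/= ->] := eqVneq (chi q) 0; first by rewrite mul0r.
  by rewrite subrr mulr0.
move=> /(congr1 X); rewrite vector_fieldM vector_field0 => /(congr1 (eval_at p)).
rewrite /eval_at !smooth_funE chi1 (Wfg _ Wp) subrr mulr0 add0r mul1r.
by rewrite vector_fieldB smooth_funE => /eqP; rewrite subr_eq0 => /eqP.
Qed.

End smooth_functions_theory.
(** * Local frames and tensoriality *)

Section local_frames.
Context {R : realType} {n : nat} {M : smooth_manifold R n}.
Local Notation F := (smooth_fun M).
Local Notation VF := (vector_field M).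
Implicit Types (f g : F) (X Y V Z : VF) (p q : M).

Lemma star_shaped_ball (x : 'rV[R]_n) (r : R) : star_shaped (ball x r) x.
Proof.
move=> y t; rewrite -ball_normE/= => yr; rewrite inE/= in_itv/= => /andP[t0 t1].
rewrite opprD addNKr normrN normrZ ger0_norm//.
by rewrite (le_lt_trans _ yr)// [leRHS]distrC ler_piMl.
Qed.

(** * Cut-off coordinate vector fields *)

Section coordinate_field.
Variables (c : chart R n M) (chi : F).
Hypotheses (ac : atlas c) (chi_dom : forall q, chi q != 0 -> chart_dom c q).
Hypothesis chi_smooth : forall h, smooth_on (chart_cod c) h ->
  smooth_function (fun q => chi q * h (chart_fun c q)).
Variable v : 'rV[R]_n.

Let coordinate_derivative f q := chi q * 'D_v (f \o chart_inv c) (chart_fun c q).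

Let coordinate_derivative_smooth f :
  coordinate_derivative f \in @smooth_function_pred R n M.
Proof.
apply/asboolP; apply: (@chi_smooth ('D_v (f \o chart_inv c))).
by apply: smooth_on_derive; exact: smooth_funP.
Qed.

Let coordinate_fieldP :
  (fun f => SmoothFun (coordinate_derivative_smooth f)) \in @derivation_pred R n M.
Proof.
have df f q : chart_dom c q -> derivable (f \o chart_inv c) (chart_fun c q) v.
  move=> cq; apply: diff_derivable; apply: (smooth_on_differentiable (smooth_funP f ac)).
  exact: chart_cod_fun.
apply/asboolP; split=> [a f g|f g]; apply: smooth_fun_ext => q; rewrite !smooth_funE /=.
  rewrite /coordinate_derivative.
  have [->|/chi_dom cq] := eqVneq (chi q) 0; first by rewrite !mul0r mulr0 addr0.
  rewrite (_ : _ \o _ = a *: (f \o chart_inv c) + (g \o chart_inv c))//.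
  rewrite deriveD; [|by apply: derivableZ; exact: df|exact: df].
  rewrite deriveZ; last exact: df.
  by rewrite mulrDr; congr (_ + _); exact: mulrCA.
rewrite /coordinate_derivative.
have [->|/chi_dom cq] := eqVneq (chi q) 0; first by rewrite !mul0r mulr0 addr0.
rewrite (_ : _ \o _ = (f \o chart_inv c) * (g \o chart_inv c))//.
rewrite deriveM; [|exact: df|exact: df].
by rewrite /GRing.scale/= chart_funK//; ring.
Qed.

Definition coordinate_field : VF := VectorField coordinate_fieldP.

Lemma coordinate_fieldE f q :
  coordinate_field f q = chi q * 'D_v (f \o chart_inv c) (chart_fun c q).
Proof. by []. Qed.

End coordinate_field.

(* By Hadamard's lemma f = f q + \sum_i (x_i - x_i q) g_i near q, with g_i smooth
   and g_i q the i-th partial derivative of f at q. *)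
Lemma vector_field_coordinates c (x : 'I_n -> F) q f X : atlas c ->
  chart_dom c q ->
  (forall i, \forall q' \near q, x i q' = chart_fun c q' 0 i) ->
  X f q = \sum_i X (x i) q *
                 'D_(delta_mx 0 i) (f \o chart_inv c) (chart_fun c q).
Proof.
move=> ac cq xE; have [oD oC _ _ _] := atlas_homeo ac.
set y := chart_fun c q.
have [r r0 rC] : exists2 r : R, 0 < r & ball y r `<=` chart_cod c.
  by apply/nbhs_ballP/open_nbhs_nbhs; split => //; exact: chart_cod_fun.
have oB : open (ball y r) by exact: ball_open.
have By : ball y r y by exact: ballxx.
have [chi [chi1 chiB chis]] := chart_bump ac oB rC cq By.
have sf : smooth_on (ball y r) (f \o chart_inv c).
  by move=> k; apply: C_k_on_subset rC _; exact: smooth_funP.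
pose h i := segment_mean y 0 ('D_(delta_mx 0 i) (f \o chart_inv c)).
have sh i : smooth_on (ball y r) (h i).
  apply: smooth_on_segment_mean => //; first exact: star_shaped_ball.
  exact: smooth_on_derive.
have /choice[g gE] i := smooth_function_exists (chis _ (sh i)).
have -> : X f q = X (f q *: (1 : F) + \sum_i (x i - x i q *: (1 : F)) * g i) q.
  apply: vector_field_local.
  have xn : \forall q' \near q, forall i, x i q' = chart_fun c q' 0 i.
    by apply: filter_forall.
  near=> q'.
  have chi1' : chi q' = 1 by near: q'.
  have [cq' Bq'] : chart_dom c q' /\ ball y r (chart_fun c q').
    by apply: chiB; rewrite chi1' oner_neq0.
  have xq' : forall i, x i q' = chart_fun c q' 0 i by near: q'.
  have := hadamard oB (@star_shaped_ball _ _) sf Bq'.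
  rewrite [(f \o _) _]/comp chart_funK// [(f \o _) _]/comp chart_funK// => ->.
  rewrite !smooth_funE mulr1 smooth_fun_sum; congr (_ + _); apply: eq_bigr => i _.
  rewrite !smooth_funE mulr1 gE chi1' mul1r xq'.
  by rewrite (nbhs_singleton (xE i)).
(* [X] kills constants, and x_i - x_i(q) vanishes at [q], so the derivatives of the [g i] drop
   out. *)
rewrite vector_fieldD vector_field_cst add0r vector_field_sum smooth_fun_sum.
apply: eq_bigr => i _; rewrite vector_fieldM vector_fieldB vector_field_cst subr0.
rewrite !smooth_funE mulr1 subrr mul0r addr0 gE (nbhs_singleton chi1) mul1r.
by rewrite /h segment_mean0.
Unshelve. all: by end_near. Qed.

(** Two nested cut-offs: [chi] is supported where the first bump is 1, so that [E] and [x] are true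
    coordinate fields and coordinates there, and the expansion of [chi *: X] holds on all of [M]. *)
Lemma local_frame p : exists (E : 'I_n -> VF) (x : 'I_n -> F) (chi : F),
  [/\ \near p, chi p = 1,
      forall i j, E i (x j) p = (i == j)%:R &
      forall X, chi *: X = \sum_i (chi * X (x i)) *: E i].
Proof.
have [c ac cp] := atlas_cover p; have [oD oC _ _ _] := atlas_homeo ac.
have [chi1 [chi1p chi1D chi1s]] :=
  chart_bump ac oC (@subset_refl _ _) cp (chart_cod_fun cp).
have chi1_dom q : chi1 q != 0 -> chart_dom c q by move=> /chi1D[].
pose E i := coordinate_field ac chi1_dom chi1s (delta_mx 0 i).
have /choice[x xE] i := smooth_function_exists (chi1s _ (@smooth_on_coord _ _ i _)).
have [W [oW Wp] W1] : exists2 W, open_nbhs p W & W `<=` [set q | chi1 q = 1].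
  by have : nbhs p [set q | chi1 q = 1] by []; rewrite nbhsE.
have Wc q : W q -> chart_dom c q.
  by move=> /W1/= h; apply: (chi1_dom q); rewrite h oner_neq0.
have xn q i : W q -> \forall q' \near q, x i q' = chart_fun c q' 0 i.
  move=> Wq; have : \near q, W q by exact: open_nbhs_nbhs.
  by apply: filterS => q' /W1/= h; rewrite xE h mul1r.
have [chi [chip chiW]] := bump_function oW Wp.
exists E, x, chi; split => // [i j|X].
  rewrite coordinate_fieldE (W1 _ Wp) mul1r.
  rewrite (@near_eq_derive _ _ _ _ (fun y : 'rV[R]_n => y 0 j)).
    by rewrite derive_coord !mxE eqxx eq_sym.
  have : \forall y \near chart_fun c p, chart_cod c y.
    by apply: open_nbhs_nbhs; split=> //; exact: chart_cod_fun.
  have : \forall y \near chart_fun c p,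
      x j (chart_inv c y) = chart_fun c (chart_inv c y) 0 j.
    have ci := chart_inv_continuous ac (chart_cod_fun cp).
    apply: (ci [set q' | x j q' = chart_fun c q' 0 j]).
    by rewrite /= chart_funK//; exact: xn.
  by apply: filterS2 => y /= -> cy; rewrite chart_invK.
apply: vector_field_ext => f q; rewrite sum_vector_fieldE smooth_fun_sum.
rewrite scale_vector_fieldE smooth_funE.
have [chi0|/chiW Wq] := eqVneq (chi q) 0.
  rewrite chi0 mul0r big1// => i _.
  by rewrite scale_vector_fieldE !smooth_funE chi0 !mul0r.
rewrite (vector_field_coordinates f X ac (Wc _ Wq) (fun i => xn _ i Wq)) mulr_sumr.
apply: eq_bigr => i _; rewrite scale_vector_fieldE !smooth_funE coordinate_fieldE.
by rewrite (W1 _ Wq) mul1r mulrA.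
Qed.

Definition tensorial (alpha : VF -> F) :=
  forall f X Y, alpha (f *: X + Y) = f * alpha X + alpha Y.

Section tensorial_theory.
Variables (alpha : VF -> F) (alphaT : tensorial alpha).

Lemma tensorialD X Y : alpha (X + Y) = alpha X + alpha Y.
Proof. by have := alphaT 1 X Y; rewrite scale1r mul1r. Qed.

Lemma tensorial0 : alpha 0 = 0.
Proof. by apply: (addrI (alpha 0)); rewrite -tensorialD !addr0. Qed.

Lemma tensorialZ f X : alpha (f *: X) = f * alpha X.
Proof. by have := alphaT f X 0; rewrite tensorial0 !addr0. Qed.

Lemma tensorialN X : alpha (- X) = - alpha X.
Proof. by rewrite -scaleN1r tensorialZ mulN1r. Qed.

Lemma tensorialB X Y : alpha (X - Y) = alpha X - alpha Y.
Proof. by rewrite tensorialD tensorialN. Qed.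

Lemma tensorial_sum m (E : 'I_m -> VF) :
  alpha (\sum_i E i) = \sum_i alpha (E i).
Proof. by apply: (big_morph alpha); [exact: tensorialD|exact: tensorial0]. Qed.

(** Replacing [X] by [chi *: X] changes nothing at [p], and the coefficients of the latter in a
    local frame vanish there. *)
Lemma tensorial_pointwise X p : (forall f, X f p = 0) -> alpha X p = 0.
Proof.
move=> Xp; have [E [x [chi [/nbhs_singleton chi1 _ chiX]]]] := local_frame p.
have : alpha (chi *: X) p = alpha X p by rewrite tensorialZ smooth_funM chi1 mul1r.
move=> <-; rewrite chiX tensorial_sum smooth_fun_sum big1// => i _.
by rewrite tensorialZ !smooth_funM Xp mulr0 mul0r.
Qed.

End tensorial_theory.

End local_frames.
(** * Representation of tensorial functionals *)

Section riesz_representation.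
Context {R : realType} {n : nat} {M : smooth_manifold R n}.
Local Notation F := (smooth_fun M).
Local Notation VF := (vector_field M).
Variable g : VF -> VF -> F.
Hypothesis g_tensorial : forall Z, tensorial (g^~ Z).
Hypothesis g_sym : forall X Y, g X Y = g Y X.
Hypothesis g_anisotropic : forall X p, g X X p = 0 -> forall f, X f p = 0.

Let g_tensorialr X : tensorial (g X).
Proof. by move=> f Y Z; rewrite ![g X _]g_sym; exact: g_tensorial. Qed.

Lemma bilinear_nondegenerate_at X (p : M) :
  (forall Z, g X Z p = 0) -> forall f, X f p = 0.
Proof. by move=> gX; exact/g_anisotropic/gX. Qed.

Lemma bilinear_nondegenerate X : (forall Z, g X Z = 0) -> X = 0.
Proof.
move=> gX; apply: vector_field_ext => f p.
by apply: (@bilinear_nondegenerate_at X p) => Z; rewrite gX.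
Qed.

Lemma local_riesz (alpha : VF -> F) (p : M) : tensorial alpha ->
  exists V, \forall q \near p, forall Z, g V Z q = alpha Z q.
Proof.
move=> aT; have [E [x [chi [chi1 Ex chiE]]]] := local_frame p.
pose G : 'M[F]_n := \matrix_(i, j) g (E i) (E j).
(* A vector in the kernel of the Gram matrix at [p] gives a field [V] that is null there; by
   anisotropy [V] vanishes at [p], and testing it on the [x j] shows that all its coefficients are
   0. *)
have detG : (\det G) p != 0.
  apply/negP; rewrite -[_ p]/(eval_at p (\det G)) -det_map_mx => /det0P[v v0 vG].
  pose V := \sum_i (v 0 i *: (1 : F)) *: E i.
  have gVE j : g V (E j) p = 0.
    rewrite (tensorial_sum (g_tensorial (E j))) smooth_fun_sum.
    have := congr1 (fun w : 'rV[R]_n => w 0 j) vG; rewrite !mxE => vGj.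
    rewrite -[RHS]vGj; apply: eq_bigr => i _.
    by rewrite (tensorialZ (g_tensorial (E j))) !smooth_funE mulr1 !mxE.
  have gVV : g V V p = 0.
    rewrite {2}/V (tensorial_sum (g_tensorialr V)) smooth_fun_sum big1// => i _.
    by rewrite (tensorialZ (g_tensorialr V)) !smooth_funE gVE mulr0.
  move/negP: v0; apply; apply/eqP/rowP => j; rewrite mxE.
  have := g_anisotropic gVV (x j).
  rewrite /V sum_vector_fieldE smooth_fun_sum (bigD1 j)// big1 ?addr0.
    by rewrite scale_vector_fieldE !smooth_funE Ex eqxx /= addr0 !mulr1.
  by move=> i ij; rewrite scale_vector_fieldE !smooth_funE Ex (negbTE ij) mulr0.
have [delta deltaG] := smooth_fun_local_inv detG.
pose a : 'rV[F]_n := \row_j alpha (E j).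
(* Cramer's rule: the adjugate solves the system up to the factor [\det G], which [delta] cancels
   near [p]. *)
pose v := a *m \adj G.
pose V := \sum_i (delta * v 0 i) *: E i.
have gVE j : g V (E j) = delta * \det G * alpha (E j).
  rewrite (tensorial_sum (g_tensorial (E j))).
  have : (v *m G) 0 j = \det G * alpha (E j).
    by rewrite -mulmxA mul_adj_mx mul_mx_scalar !mxE.
  rewrite mxE -mulrA => <-; rewrite mulr_sumr; apply: eq_bigr => i _.
  by rewrite (tensorialZ (g_tensorial (E j))) [G i j]mxE mulrA.
exists V; apply: filterS2 chi1 deltaG => q chi1 deltaG Z.
have -> : g V Z q = g V (chi *: Z) q.
  by rewrite (tensorialZ (g_tensorialr V)) smooth_funM chi1 mul1r.
have -> : alpha Z q = alpha (chi *: Z) q.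
  by rewrite (tensorialZ aT) smooth_funM chi1 mul1r.
rewrite chiE (tensorial_sum (g_tensorialr V)) (tensorial_sum aT) !smooth_fun_sum.
apply: eq_bigr => i _; rewrite (tensorialZ (g_tensorialr V)) (tensorialZ aT) gVE.
rewrite [LHS]smooth_funM [RHS]smooth_funM [in LHS](smooth_funM (delta * _)).
by rewrite (smooth_funM delta) deltaG mul1r.
Qed.

Lemma riesz (alpha : VF -> F) : tensorial alpha ->
  exists V, forall Z, g V Z = alpha Z.
Proof.
move=> aT; have /choice[V gV] (p : M) := local_riesz p aT.
(* Two local solutions that both represent [alpha] at [q] have the same value at [q], so q |-> V q f
   q is locally one of the smooth functions [V p f]. *)
have VV (p q : M) f : (forall Z, g (V p) Z q = alpha Z q) -> V p f q = V q f q.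
  move=> gVp; apply/eqP; rewrite -subr_eq0; apply/eqP.
  apply: (@bilinear_nondegenerate_at (V p - V q) q) => Z.
  rewrite (tensorialB (g_tensorial Z)) smooth_funB gVp.
  by rewrite (nbhs_singleton (gV q)) subrr.
have Vs f : smooth_function (fun q => V q f q).
  apply: smooth_function_glue => p; exists (V p f).
  by apply: filterS (gV p) => q /VV ->.
have /choice[D DE] f := smooth_function_exists (Vs f).
have DP : D \in @derivation_pred R n M.
  apply/asboolP; split=> [a f h|f h]; apply: smooth_fun_ext => q.
    by rewrite !smooth_funE !DE vector_fieldD vector_fieldZ !smooth_funE.
  by rewrite !smooth_funE !DE vector_fieldM !smooth_funE.
exists (VectorField DP) => Z; apply: smooth_fun_ext => q.
(* The glued field and [V q] agree at [q], hence so do their products with [Z]. *)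
rewrite -(nbhs_singleton (gV q) Z); apply/eqP; rewrite -subr_eq0 -smooth_funB.
rewrite -(tensorialB (g_tensorial Z)); apply/eqP.
apply: (tensorial_pointwise (g_tensorial Z)) => f.
by rewrite add_vector_fieldE opp_vector_fieldE !smooth_funE /= DE subrr.
Qed.

End riesz_representation.
(** * The Koszul formula *)

Section lie_brackets.
Context {R : realType} {n : nat} {M : smooth_manifold R n}.
Local Notation F := (smooth_fun M).
Implicit Types (X Y Z : vector_field M) (f : F).

Lemma vector_field_eq X Y : (forall f, X f = Y f) -> X = Y.
Proof. by move=> XY; apply: vector_field_ext => f p; rewrite XY. Qed.

Lemma lie_bracketE X Y f : lie_bracket X Y f = X (Y f) - Y (X f).
Proof. by []. Qed.

Lemma lie_bracketC X Y : lie_bracket Y X = - lie_bracket X Y.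
Proof.
by apply: vector_field_eq => f; rewrite opp_vector_fieldE !lie_bracketE opprB.
Qed.

Lemma lie_bracketxx X : lie_bracket X X = 0.
Proof. by apply: vector_field_eq => f; rewrite lie_bracketE subrr. Qed.

Lemma lie_bracket_linear_r X f Y Z :
  lie_bracket X (f *: Y + Z) = X f *: Y + f *: lie_bracket X Y + lie_bracket X Z.
Proof.
apply: vector_field_eq => u.
rewrite !(add_vector_fieldE, scale_vector_fieldE, lie_bracketE).
rewrite vector_fieldD vector_fieldM; ring.
Qed.

Lemma lie_bracket_linear_l f X Y Z :
  lie_bracket (f *: X + Y) Z = f *: lie_bracket X Z + lie_bracket Y Z - Z f *: X.
Proof.
apply: vector_field_eq => u.
rewrite !(add_vector_fieldE, opp_vector_fieldE, scale_vector_fieldE, lie_bracketE).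
rewrite vector_fieldD vector_fieldM; ring.
Qed.

Lemma lie_bracketDr X Y Z : lie_bracket X (Y + Z) = lie_bracket X Y + lie_bracket X Z.
Proof.
by have := lie_bracket_linear_r X 1 Y Z; rewrite vector_field1 scale0r add0r !scale1r.
Qed.

Lemma lie_bracketZr X f Y : lie_bracket X (f *: Y) = X f *: Y + f *: lie_bracket X Y.
Proof.
apply: vector_field_eq => u.
by rewrite !(add_vector_fieldE, scale_vector_fieldE, lie_bracketE) vector_fieldM; ring.
Qed.

Lemma exterior_derivativeC (A : one_form M) X Y :
  exterior_derivative A Y X = - exterior_derivative A X Y.
Proof. by rewrite /exterior_derivative (lie_bracketC X) linearN; ring. Qed.

Lemma exterior_derivative_tensorial (A : one_form M) X :
  tensorial (exterior_derivative A X).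
Proof.
move=> f Y Z; rewrite /exterior_derivative lie_bracket_linear_r add_vector_fieldE.
rewrite scale_vector_fieldE !linearD !linearZ /= vector_fieldD vector_fieldM; ring.
Qed.

End lie_brackets.

(** * The Koszul functional and its identities *)

Section koszul_form.
Context {R : realType} {n : nat} {M : smooth_manifold R n}.
Local Notation F := (smooth_fun M).
Local Notation VF := (vector_field M).
Implicit Types (X Y Z : VF) (f : F).
Variables (g : VF -> VF -> F) (xi : VF) (A : one_form M).
Hypotheses (g_tensorial : forall Z, tensorial (g^~ Z))
  (g_sym : forall X Y, g X Y = g Y X).

Let gDl X Y Z : g (X + Y) Z = g X Z + g Y Z.
Proof. exact: (tensorialD (g_tensorial Z)). Qed.
Let gZl f X Z : g (f *: X) Z = f * g X Z.
Proof. exact: (tensorialZ (g_tensorial Z)). Qed.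
Let gNl X Z : g (- X) Z = - g X Z.
Proof. exact: (tensorialN (g_tensorial Z)). Qed.
Let gDr X Y Z : g Z (X + Y) = g Z X + g Z Y.
Proof. by rewrite g_sym gDl !(g_sym Z). Qed.
Let gZr f X Z : g Z (f *: X) = f * g Z X.
Proof. by rewrite g_sym gZl (g_sym Z). Qed.
Let gNr X Z : g Z (- X) = - g Z X.
Proof. by rewrite g_sym gNl (g_sym Z). Qed.
Let gE := (gDl, gDr, gZl, gZr, gNl, gNr).
Local Notation L := (lie_derivative_bilinear xi g).

Lemma lie_derivative_bilinear_sym X Y : L X Y = L Y X.
Proof.
rewrite /lie_derivative_bilinear (g_sym Y X) (g_sym (lie_bracket xi Y)).
by rewrite (g_sym Y (lie_bracket xi X)); ring.
Qed.

Lemma lie_derivative_bilinear_tensorial X : tensorial (L X).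
Proof.
move=> f Y Z; rewrite /lie_derivative_bilinear lie_bracket_linear_r !gE.
rewrite vector_fieldD vector_fieldM; ring.
Qed.

(* Twice the right-hand side of Koszul's formula for Z in the kernels of psi and
   A; the last term is the contribution of the torsion prescribed by U = 0. *)
Definition koszul_form X Y Z : F :=
  X (g Y Z) + Y (g X Z) - Z (g X Y) + g (lie_bracket X Y) Z
  - g (lie_bracket X Z) Y - g (lie_bracket Y Z) X - A Y * L X Z.

(** The terms [X f] and [Y f] produced by the derivatives of the products cancel those produced by
    the brackets. *)
Lemma koszul_form_tensorial X Y : tensorial (koszul_form X Y).
Proof.
move=> f Z W; rewrite /koszul_form (lie_derivative_bilinear_tensorial X f Z W).
rewrite !lie_bracket_linear_r !gE !vector_fieldD !vector_fieldM.
rewrite add_vector_fieldE scale_vector_fieldE (g_sym Z Y) (g_sym Z X); ring.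
Qed.

Lemma koszul_form_tensorial_l Y Z : tensorial (fun X => koszul_form X Y Z).
Proof.
move=> f X X'; rewrite /koszul_form.
rewrite (lie_derivative_bilinear_sym (f *: X + X')).
rewrite (lie_derivative_bilinear_tensorial Z f X X').
rewrite !(lie_derivative_bilinear_sym Z).
rewrite !lie_bracket_linear_l !gE !vector_fieldD !vector_fieldM.
rewrite add_vector_fieldE scale_vector_fieldE; ring.
Qed.

(** The defect is twice [X f * g Y Z]; once halved it is the Leibniz term of a connection. *)
Lemma koszul_form_leibniz X f Y Z :
  koszul_form X (f *: Y) Z =
  f * koszul_form X Y Z + (X f * g Y Z + X f * g Y Z) .
Proof.
rewrite /koszul_form !lie_bracketZr (lie_bracketC Z (f *: Y)) lie_bracketZr.
rewrite (lie_bracketC Z Y).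
rewrite !gE !vector_fieldM linearZ scale_vector_fieldE /= (g_sym X Y); ring.
Qed.

Lemma koszul_formDm X Y Y' Z :
  koszul_form X (Y + Y') Z = koszul_form X Y Z + koszul_form X Y' Z.
Proof.
rewrite /koszul_form !lie_bracketDr (lie_bracketC Z (_ + _)) lie_bracketDr.
rewrite !(lie_bracketC Z) !gE !vector_fieldD (linearD A) add_vector_fieldE; ring.
Qed.

Lemma koszul_form_metric X Y Z : A Y = 0 -> A Z = 0 ->
  koszul_form X Y Z + koszul_form X Z Y = X (g Y Z) + X (g Y Z).
Proof.
move=> AY AZ; rewrite /koszul_form AY AZ (g_sym Z Y) (lie_bracketC Y Z) gE.
ring.
Qed.

Lemma koszul_form_torsion X Y Z :
  koszul_form X Y Z - koszul_form Y X Z =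
  g (lie_bracket X Y) Z + g (lie_bracket X Y) Z + (A X * L Y Z - A Y * L X Z).
Proof.
rewrite /koszul_form (lie_bracketC X Y) gE (g_sym Y X); ring.
Qed.

(** The surviving terms assemble into the Lie derivative of [g] along [xi], which the last term of
    the Koszul form subtracts. This is the source of nabla xi = 0. *)
Lemma koszul_form_radical X Z : (forall Y, g xi Y = 0) -> A xi = 1 ->
  koszul_form X xi Z = 0.
Proof.
move=> gxi Axi; have gxir Y : g Y xi = 0 by rewrite g_sym.
rewrite /koszul_form Axi /lie_derivative_bilinear !gxi !gxir !vector_field0.
by rewrite (lie_bracketC xi X) gE (g_sym X (lie_bracket xi Z)); ring.
Qed.

(** As for [xi], except that [A N = 0] removes the subtracted term. The symmetry of the Lie
    derivative will make g(nabla_X N, Y) symmetric. *)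
Lemma koszul_form_lie_derivative X N Z : (forall Y, g N Y = 0) -> A N = 0 ->
  koszul_form X N Z = lie_derivative_bilinear N g X Z.
Proof.
move=> gN AN; have gNr' Y : g Y N = 0 by rewrite g_sym.
rewrite /koszul_form AN /lie_derivative_bilinear !gN !gNr' !vector_field0.
by rewrite (lie_bracketC N X) gE (g_sym X (lie_bracket N Z)); ring.
Qed.

End koszul_form.
(** * Connections with vanishing fieldstrength *)

Section leibnizian_metric.
Context {R : realType} {n : nat} {M : smooth_manifold R n}.
Local Notation F := (smooth_fun M).
Local Notation VF := (vector_field M).
Variables (xi : VF) (psi : one_form M) (gamma : VF -> VF -> F).
Variables (N : VF) (A : one_form M).
Hypotheses (hM : ambient_leibnizian xi psi gamma)
  (hNA : invariant_leibnizian_pair xi psi N A).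
Implicit Types (f : F) (X Y Z V W : VF) (p : M).

Local Notation g := (transverse_metric psi gamma N).

Let psiN : psi N = 1. Proof. by case: hNA. Qed.
Let Axi : A xi = 1. Proof. by case: hNA. Qed.
Let AN : A N = 0. Proof. by case: hNA. Qed.
Let psixi : psi xi = 0. Proof. by case: hM. Qed.

Lemma one_form_tensorial (a : one_form M) : tensorial a.
Proof. by move=> f X Y; rewrite linearD linearZ. Qed.

Definition clock_part X := X - psi X *: N.
(** The projection along [N] and [xi] onto the common kernel of [psi] and [A]. *)
Definition spatial_part X := clock_part X - A X *: xi.

Lemma psi_clock_part X : psi (clock_part X) = 0.
Proof. by rewrite linearB linearZ /= psiN mulr1 subrr. Qed.

Lemma psi_spatial_part X : psi (spatial_part X) = 0.
Proof. by rewrite linearB linearZ /= psi_clock_part psixi mulr0 subr0. Qed.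

Lemma A_spatial_part X : A (spatial_part X) = 0.
Proof. by rewrite !linearB !linearZ /= AN Axi mulr0 mulr1 subr0 subrr. Qed.

Lemma clock_part_id V : psi V = 0 -> clock_part V = V.
Proof. by move=> V0; rewrite /clock_part V0 scale0r subr0. Qed.

Lemma clock_part_linear f X Y :
  clock_part (f *: X + Y) = f *: clock_part X + clock_part Y.
Proof.
rewrite /clock_part (one_form_tensorial psi) scalerBr.
by rewrite [(_ + _) *: N]scalerDl -scalerA opprD addrACA.
Qed.

Lemma spatial_part_linear f X Y :
  spatial_part (f *: X + Y) = f *: spatial_part X + spatial_part Y.
Proof.
rewrite /spatial_part clock_part_linear (one_form_tensorial A).
move: (clock_part X) (clock_part Y) => cX cY.
by rewrite scalerBr [(_ + _) *: xi]scalerDl -scalerA opprD addrACA.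
Qed.

Lemma transverse_metricE X Y : g X Y = gamma (clock_part X) (clock_part Y).
Proof. by []. Qed.

Lemma transverse_metric_tensorial Z : tensorial (g^~ Z).
Proof.
move=> f X Y; rewrite !transverse_metricE clock_part_linear.
by rewrite (leibnizian_linear hM)// psi_clock_part.
Qed.

Lemma transverse_metric_sym X Y : g X Y = g Y X.
Proof. by apply: (leibnizian_sym hM); exact: psi_clock_part. Qed.

Let gT := transverse_metric_tensorial.
Let gC := transverse_metric_sym.
Let gDl X Y Z : g (X + Y) Z = g X Z + g Y Z := tensorialD (gT Z) X Y.
Let gZl f X Z : g (f *: X) Z = f * g X Z := tensorialZ (gT Z) f X.
Let gBl X Y Z : g (X - Y) Z = g X Z - g Y Z := tensorialB (gT Z) X Y.
Let gDr X Y Z : g Z (X + Y) = g Z X + g Z Y.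
Proof. by rewrite gC gDl !(gC Z). Qed.
Let gZr f X Z : g Z (f *: X) = f * g Z X.
Proof. by rewrite gC gZl (gC Z). Qed.
Let gr0 Z : g Z 0 = 0.
Proof. by rewrite gC; exact: tensorial0 (gT Z). Qed.
Let gBr X Y Z : g Z (X - Y) = g Z X - g Z Y.
Proof. by rewrite gC gBl !(gC Z). Qed.

Lemma transverse_metric_ker V W : psi V = 0 -> psi W = 0 -> g V W = gamma V W.
Proof. by move=> V0 W0; rewrite transverse_metricE !clock_part_id. Qed.

Lemma transverse_metric_xi Y : g xi Y = 0.
Proof.
apply: smooth_fun_ext => p; rewrite transverse_metricE (clock_part_id psixi).
apply: ((leibnizian_radical hM p psixi).2 _ _ (psi_clock_part Y)).
by exists 1 => f; rewrite mul1r.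
Qed.

Lemma transverse_metric_N Y : g N Y = 0.
Proof.
have : clock_part N = 0 by rewrite /clock_part psiN scale1r subrr.
rewrite transverse_metricE => ->; have psi0 : psi 0 = 0 by exact: linear0.
(* Linearity on the kernel of [psi], used at zero vectors, gives gamma(0, Y') = 2 gamma(0, Y'). *)
have := leibnizian_linear hM 1 psi0 psi0 (psi_clock_part Y).
by rewrite scaler0 addr0 mul1r => /eqP; rewrite -subr_eq0 opprD addNKr oppr_eq0 => /eqP.
Qed.

Let gxi := transverse_metric_xi.
Let gN := transverse_metric_N.
Let gxir Y : g Y xi = 0. Proof. by rewrite gC. Qed.
Let gNr Y : g Y N = 0. Proof. by rewrite gC. Qed.

Lemma transverse_metric_spatial X Y : g X (spatial_part Y) = g X Y.
Proof. by rewrite !gBr !gZr gxir gNr !mulr0 !subr0. Qed.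

Lemma transverse_metric_ge0 X p : 0 <= g X X p.
Proof. by apply: (leibnizian_semidefinite hM); exact: psi_clock_part. Qed.

(* Otherwise g (t X + Y) (t X + Y) would take the value -1 at p for some real t. *)
Lemma transverse_metric_null X Y p : g X X p = 0 -> g X Y p = 0.
Proof.
move=> gXX; apply/eqP/negP => /negP gXY.
pose t := - (g Y Y p + 1) / (2 * g X Y p).
have := transverse_metric_ge0 ((t *: (1 : F)) *: X + Y) p.
rewrite gDl !gDr !gZl !gZr (gC Y X) !smooth_funE gXX.
rewrite (_ : _ + _ = -1) ?ler0N1//.
by rewrite /t; field.
Qed.

(* A definite extension of g to all of TM, which turns the Koszul formula together
   with the prescribed values of psi and A into a single Riesz problem. *)
Definition ambient_metric X Y : F := g X Y + psi X * psi Y + A X * A Y.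

Lemma ambient_metric_tensorial Z : tensorial (ambient_metric^~ Z).
Proof.
move=> f X Y; rewrite /ambient_metric gT !one_form_tensorial; ring.
Qed.

Lemma ambient_metric_sym X Y : ambient_metric X Y = ambient_metric Y X.
Proof. by rewrite /ambient_metric gC [psi X * _]mulrC [A X * _]mulrC. Qed.

Lemma ambient_metric_anisotropic X p : ambient_metric X X p = 0 ->
  forall f, X f p = 0.
Proof.
rewrite /ambient_metric !smooth_funE => sum0.
have g0 := transverse_metric_ge0 X p.
have gp : g X X p = 0 by nra.
have psip : psi X p = 0 by apply/eqP; rewrite -sqrf_eq0; apply/eqP; nra.
have Ap : A X p = 0 by apply/eqP; rewrite -sqrf_eq0; apply/eqP; nra.
(* A null vector of a semi-definite form lies in its radical, here the line of [xi]; [A X p = 0]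
   then forces the factor [c] to be 0. *)
have [c Xc] : exists c : R, forall f, clock_part X f p = c * xi f p.
  apply/(leibnizian_radical hM p (psi_clock_part X)) => W W0.
  by rewrite -(clock_part_id W0); exact: transverse_metric_null.
have c0 : c = 0.
  have : A (clock_part X - (c *: (1 : F)) *: xi) p = 0.
    apply: (tensorial_pointwise (one_form_tensorial A)) => f.
    rewrite -[LHS]/(clock_part X f p - c * 1 * xi f p).
    by rewrite Xc mulr1 subrr.
  have AT := one_form_tensorial A.
  have -> : A (clock_part X - (c *: (1 : F)) *: xi) = A X - c *: (1 : F).
    by rewrite /clock_part !(tensorialB AT) !(tensorialZ AT) AN Axi mulr0 subr0 mulr1.
  by rewrite !smooth_funE Ap mulr1 sub0r => /eqP; rewrite oppr_eq0 => /eqP.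
move=> f; have := Xc f; rewrite c0 mul0r.
rewrite -[LHS]/(X f p - psi X p * N f p) psip.
by rewrite mul0r subr0.
Qed.

(** Nondegeneracy of the ambient metric; [g] sees only the spatial part of [Z], so spatial test
    fields suffice. *)
Lemma vector_field_components V W : psi V = psi W -> A V = A W ->
  (forall Z, psi Z = 0 -> A Z = 0 -> g V Z = g W Z) -> V = W.
Proof.
move=> psiVW AVW gVW; apply/eqP; rewrite -subr_eq0; apply/eqP.
apply: (bilinear_nondegenerate ambient_metric_anisotropic) => Z.
rewrite (tensorialB (ambient_metric_tensorial Z)) /ambient_metric psiVW AVW.
rewrite -(transverse_metric_spatial V) -(transverse_metric_spatial W).
by rewrite gVW ?psi_spatial_part ?A_spatial_part// subrr.
Qed.

Local Notation K := (koszul_form g xi A).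
Local Notation L := (lie_derivative_bilinear xi g).
Local Notation dA := (exterior_derivative A).
(** One half as an element of the ring C^oo(M), so that [ring] meets products instead of scalings by
    reals. *)
Let half : F := (2^-1 : R) *: (1 : F).

Let halfE f : (2^-1 : R) *: f = half * f.
Proof. by apply: smooth_fun_ext => p; rewrite !smooth_funE mulr1. Qed.

Let quarterE f : (4^-1 : R) *: f = half * (half * f).
Proof. by apply: smooth_fun_ext => p; rewrite !smooth_funE; field. Qed.

Let half_half : half + half = 1.
Proof. by apply: smooth_fun_ext => p; rewrite !smooth_funE; field. Qed.

Let half2 f : half * (f + f) = f.
Proof. by rewrite mulrDr -mulrDl half_half mul1r. Qed.

Let half_eq0 f : half * f = 0 -> f = 0.
Proof. by move=> f0; rewrite -(half2 f) mulrDr f0 addr0. Qed.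

(** Prescribes all components of nabla_X Y without presupposing a connection. Both existence and
    uniqueness pass through this description. *)
Definition zero_fieldstrength_connection (nabla : VF -> VF -> VF) := forall X Y,
  [/\ psi (nabla X Y) = X (psi Y), A (nabla X Y) = X (A Y) - half * dA X Y &
      forall Z, psi Z = 0 -> A Z = 0 -> g (nabla X Y) Z = half * K X Y Z].

Let K_tensorial := koszul_form_tensorial xi A gT gC.

Lemma zero_fieldstrength_connection_exists :
  exists nabla, zero_fieldstrength_connection nabla.
Proof.
(* The Koszul form applies only to spatial fields, hence the projection of [Z]. Taking [Z] equal to
   [N], to [xi] or spatial then isolates the three components. *)
have /choice[nabla nablaP] (XY : VF * VF) : exists V, forall Z,
    ambient_metric V Z = half * K XY.1 XY.2 (spatial_part Z) +
      psi Z * XY.1 (psi XY.2) + A Z * (XY.1 (A XY.2) - half * dA XY.1 XY.2).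
  apply: (riesz ambient_metric_tensorial ambient_metric_sym ambient_metric_anisotropic).
  move=> f Z W; rewrite !one_form_tensorial.
  rewrite spatial_part_linear K_tensorial; ring.
exists (fun X Y => nabla (X, Y)) => X Y; have /= nP := nablaP (X, Y).
have K0 : K X Y 0 = 0 := tensorial0 (K_tensorial X Y).
have psiE : psi (nabla (X, Y)) = X (psi Y).
  have := nP N; rewrite /ambient_metric gNr psiN AN.
  have -> : spatial_part N = 0.
    by rewrite /spatial_part /clock_part psiN AN scale1r subrr scale0r subr0.
  by rewrite K0 !mulr0 !mul0r !addr0 !add0r mulr1 mul1r.
have AE : A (nabla (X, Y)) = X (A Y) - half * dA X Y.
  have := nP xi; rewrite /ambient_metric gxir psixi Axi.
  have -> : spatial_part xi = 0.
    by rewrite /spatial_part (clock_part_id psixi) Axi scale1r subrr.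
  by rewrite K0 !mulr0 !mul0r !add0r mulr1 mul1r.
split=> // Z psiZ AZ; have := nP Z; rewrite /ambient_metric psiZ AZ !mulr0 !mul0r !addr0.
by move=> ->; rewrite /spatial_part (clock_part_id psiZ) AZ scale0r subr0.
Qed.

Lemma dA_xi X : dA X xi = 0.
Proof.
rewrite exterior_derivativeC /exterior_derivative Axi vector_field1 subr0.
by have := pair_A_invariant hNA X; rewrite /lie_derivative_form => ->; rewrite oppr0.
Qed.

Lemma L_xi X : L X xi = 0.
Proof.
by rewrite /lie_derivative_bilinear !gxir vector_field0 lie_bracketxx gr0; ring.
Qed.

Lemma L_N X : L X N = 0.
Proof.
by rewrite /lie_derivative_bilinear !gNr vector_field0 (pair_N_invariant hNA) gr0; ring.
Qed.

(** The Lie derivative of [g] along [xi] annihilates [xi], and also [N] since [xi, N] = 0. *)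
Lemma lie_derivative_metric_spatial X Z : L X (spatial_part Z) = L X Z.
Proof.
have LT := lie_derivative_bilinear_tensorial xi gT gC X.
rewrite /spatial_part /clock_part !(tensorialB LT) !(tensorialZ LT) L_xi L_N; ring.
Qed.

(** * The Koszul formula yields a Galilean connection *)

Section sufficiency.
Variables (nabla : VF -> VF -> VF) (nablaP : zero_fieldstrength_connection nabla).

Let psi_nabla X Y : psi (nabla X Y) = X (psi Y). Proof. by have [] := nablaP X Y. Qed.
Let A_nabla X Y : A (nabla X Y) = X (A Y) - half * dA X Y.
Proof. by have [] := nablaP X Y. Qed.
Let g_nabla X Y Z : g (nabla X Y) Z = half * K X Y (spatial_part Z).
Proof.
have [_ _ h] := nablaP X Y; rewrite -transverse_metric_spatial h//.
  exact: psi_spatial_part.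
exact: A_spatial_part.
Qed.

Lemma zero_fieldstrength_koszul : koszul_connection nabla.
Proof.
split=> [f X X' Y|X Y Y'|X f Y]; apply: vector_field_components.
- by rewrite one_form_tensorial !psi_nabla.
- rewrite one_form_tensorial !A_nabla !(exterior_derivativeC A Y).
  rewrite exterior_derivative_tensorial add_vector_fieldE scale_vector_fieldE; ring.
- move=> Z _ _; rewrite gDl gZl !g_nabla.
  rewrite (koszul_form_tensorial_l xi A gT gC Y _ f X X'); ring.
- by rewrite linearD !psi_nabla linearD vector_fieldD.
- rewrite linearD !A_nabla (linearD A) vector_fieldD.
  rewrite (tensorialD (exterior_derivative_tensorial A X)); ring.
- move=> Z _ _; rewrite gDl !g_nabla (koszul_formDm xi A gT gC); ring.
- rewrite (tensorialD (one_form_tensorial psi)) !(tensorialZ (one_form_tensorial psi)).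
  by rewrite !psi_nabla (tensorialZ (one_form_tensorial psi)) vector_fieldM.
- rewrite (tensorialD (one_form_tensorial A)) !(tensorialZ (one_form_tensorial A)).
  rewrite !A_nabla (tensorialZ (one_form_tensorial A)) vector_fieldM.
  rewrite (tensorialZ (exterior_derivative_tensorial A X)); ring.
- move=> Z psiZ AZ; rewrite gDl !gZl !g_nabla (koszul_form_leibniz xi A gT gC).
  by rewrite [half * (_ + _)]mulrDr half2 transverse_metric_spatial; ring.
Qed.

Lemma zero_fieldstrength_xi X : nabla X xi = 0.
Proof.
apply: vector_field_components => [||Z _ _].
- by rewrite psi_nabla psixi vector_field0 linear0.
- by rewrite A_nabla Axi vector_field1 dA_xi mulr0 subr0 linear0.
- rewrite g_nabla (koszul_form_radical gT gC _ _ gxi Axi).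
  by rewrite mulr0 gC gr0.
Qed.

Lemma zero_fieldstrength_gamma X V W : psi V = 0 -> psi W = 0 ->
  X (gamma V W) = gamma (nabla X V) W + gamma V (nabla X W).
Proof.
have koszul_spatial Y Z : psi Y = 0 -> K X Y Z = K X (spatial_part Y) Z.
  move=> Y0; have {1}-> : Y = A Y *: xi + spatial_part Y.
    by rewrite /spatial_part (clock_part_id Y0) addrC subrK.
  rewrite (koszul_formDm xi A gT gC) (koszul_form_leibniz xi A gT gC).
  by rewrite (koszul_form_radical gT gC _ _ gxi Axi) gxi; ring.
move=> V0 W0.
rewrite -(transverse_metric_ker V0 W0).
rewrite -!transverse_metric_ker ?psi_nabla ?V0 ?W0 ?vector_field0//.
rewrite (gC V (nabla X W)) !g_nabla (koszul_spatial _ _ V0).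
rewrite (koszul_spatial _ _ W0) -mulrDr.
rewrite (koszul_form_metric xi gT gC) ?A_spatial_part// half2.
rewrite transverse_metric_spatial (gC (spatial_part V)).
by rewrite transverse_metric_spatial (gC W).
Qed.

Lemma zero_fieldstrength_Sigma X Y : fieldstrength_Sigma nabla A X Y = 0.
Proof. by rewrite /fieldstrength_Sigma A_nabla halfE; ring. Qed.

(** The Koszul form at [N] is the Lie derivative of [g] along [N]; this kills [N] and, as [xi, N] =
    0, also [xi], so the spatial projection of [Y] disappears. *)
Lemma zero_fieldstrength_shape X Y :
  g (nabla X N) Y = half * lie_derivative_bilinear N g X Y.
Proof.
rewrite g_nabla (koszul_form_lie_derivative xi gT gC _ _ gN AN).
have LT := lie_derivative_bilinear_tensorial N gT gC X.
have LN : lie_derivative_bilinear N g X N = 0.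
  by rewrite /lie_derivative_bilinear !gNr vector_field0 lie_bracketxx gr0; ring.
have Lx : lie_derivative_bilinear N g X xi = 0.
  rewrite /lie_derivative_bilinear !gxir vector_field0 (lie_bracketC xi N).
  by rewrite (pair_N_invariant hNA) !oppr0 gr0; ring.
rewrite /spatial_part /clock_part !(tensorialB LT) !(tensorialZ LT) LN Lx.
by rewrite !mulr0 !subr0.
Qed.

Lemma zero_fieldstrength_U Z X Y : fieldstrength_U xi psi gamma nabla N A Z X Y = 0.
Proof.
rewrite /fieldstrength_U /torsion !halfE quarterE !gBl !zero_fieldstrength_shape.
rewrite (lie_derivative_bilinear_sym N gC Y X) subrr !mulr0 subr0.
rewrite !g_nabla; have := koszul_form_torsion xi A gT gC X Y (spatial_part Z).
move=> /(congr1 ( *%R half)); rewrite mulrBr.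
rewrite (mulrDr half (g (lie_bracket X Y) _ + _)) half2 => ->.
rewrite !transverse_metric_spatial !lie_derivative_metric_spatial; ring.
Qed.

End sufficiency.

Lemma zero_fieldstrength_galilean nabla : zero_fieldstrength_connection nabla ->
  ambient_galilean_connection xi psi gamma nabla /\
  vanishing_fieldstrength xi psi gamma nabla N A.
Proof.
move=> nablaP; split; last first.
  by split; [exact: zero_fieldstrength_Sigma|exact: zero_fieldstrength_U].
split; first exact: zero_fieldstrength_koszul.
- exact: zero_fieldstrength_xi.
- by move=> X Y; have [-> _ _] := nablaP X Y; rewrite subrr.
- exact: zero_fieldstrength_gamma.
Qed.

(** * Vanishing fieldstrength forces the Koszul formula *)

Section necessity.
Variable nabla : VF -> VF -> VF.
Hypotheses (nablaG : ambient_galilean_connection xi psi gamma nabla)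
  (nabla0 : vanishing_fieldstrength xi psi gamma nabla N A).

Let psi_nabla X Y : psi (nabla X Y) = X (psi Y).
Proof. by have /eqP := galilean_psi nablaG X Y; rewrite subr_eq0 => /eqP. Qed.

Let A_nabla X Y : A (nabla X Y) = X (A Y) - half * dA X Y.
Proof.
have [Sigma0 _] := nabla0; have := Sigma0 X Y; rewrite /fieldstrength_Sigma halfE.
by move=> /eqP; rewrite addr_eq0 subr_eq addrC => /eqP.
Qed.

(** Set [Z] to [N] in U = 0: the torsion and Lie derivative terms die and psi N = 1 leaves the
    antisymmetric part. *)
Let shape_sym X Y : g (nabla X N) Y = g (nabla Y N) X.
Proof.
have [_ U0] := nabla0; have := U0 N X Y.
rewrite /fieldstrength_U gNr scaler0 !L_N !mulr0 subrr scaler0 psiN mul1r subrr sub0r.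
rewrite halfE => /eqP; rewrite oppr_eq0 => /eqP/half_eq0/eqP.
by rewrite subr_eq0 => /eqP.
Qed.

Let torsion_nabla X Y Z : g (nabla X Y) Z = g (nabla Y X) Z + g (lie_bracket X Y) Z +
  half * (A X * L Y Z - A Y * L X Z).
Proof.
have [_ U0] := nabla0; have := U0 Z X Y.
rewrite /fieldstrength_U shape_sym subrr mulr0 scaler0 subr0 halfE quarterE -mulrBr.
move=> /half_eq0/eqP; rewrite subr_eq0 => /eqP <-.
by rewrite /torsion !gBl; ring.
Qed.

(** Compatibility with [gamma] holds only on the kernel of [psi], so it is applied to clock parts.
    Differentiating their components along [N] creates the last two terms. *)
Let metric_nabla X Y Z : X (g Y Z) = g (nabla X Y) Z + g (nabla X Z) Y
  - psi Y * g (nabla X N) Z - psi Z * g (nabla X N) Y.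
Proof.
have [_ nablaD nablaL] := galilean_connection nablaG.
have nabla_clock V : nabla X (clock_part V) =
    nabla X V + (X (- psi V) *: N + - psi V *: nabla X N).
  by rewrite /clock_part -scaleNr nablaD nablaL.
have g_clock V W : g V (clock_part W) = g V W by rewrite gBr gZr gNr mulr0 subr0.
rewrite transverse_metricE (galilean_gamma nablaG) ?psi_clock_part//.
have psi0 V : psi (nabla X (clock_part V)) = 0.
  by rewrite psi_nabla psi_clock_part vector_field0.
rewrite -!transverse_metric_ker ?psi_clock_part//.
rewrite (gC (clock_part Y)) !g_clock !nabla_clock !gDl !gZl !gN; ring.
Qed.

Lemma vanishing_fieldstrength_connection : zero_fieldstrength_connection nabla.
Proof.
move=> X Y; split=> // Z psiZ AZ.
(* The terms carrying [psi X] and [psi Y] cancel in pairs by the symmetry of g(nabla_X N, Y). *)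
rewrite /koszul_form !metric_nabla psiZ !mul0r !subr0.
rewrite (shape_sym Z X) (shape_sym Z Y).
have TYX := torsion_nabla X Y Z.
rewrite (torsion_nabla X Z Y) (torsion_nabla Y Z X) AZ !mul0r !subr0.
rewrite (lie_derivative_bilinear_sym xi gC Z Y) (lie_derivative_bilinear_sym xi gC Z X).
have {}TYX : g (nabla Y X) Z = g (nabla X Y) Z - g (lie_bracket X Y) Z -
    half * (A X * L Y Z - A Y * L X Z) by rewrite TYX; ring.
rewrite TYX -[LHS]half2; congr (half * _).
(* [half] is an atom for [ring], so the relation [half + half = 1] is supplied by hand. *)
transitivity (g (nabla X Y) Z + g (nabla X Y) Z + (half + half - 1) * (A Y * L X Z)).
  by rewrite half_half subrr mul0r addr0.
ring.
Qed.

End necessity.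

End leibnizian_metric.

Theorem proposition3p13 (R : realType) (d : nat) (M : smooth_manifold R d.+2)
    (xi : vector_field M) (psi : one_form M)
    (gamma : vector_field M -> vector_field M -> smooth_fun M)
    (N : vector_field M) (A : one_form M)
    (hM : ambient_leibnizian xi psi gamma)
    (hNA : invariant_leibnizian_pair xi psi N A) :
  exists! nabla : vector_field M -> vector_field M -> vector_field M,
    ambient_galilean_connection xi psi gamma nabla /\
    vanishing_fieldstrength xi psi gamma nabla N A.
Proof.
have [nabla nablaP] := zero_fieldstrength_connection_exists hM hNA.
exists nabla; split; first exact: (zero_fieldstrength_galilean hM hNA).
move=> nabla' [nablaG nabla0].
have nablaP' := vanishing_fieldstrength_connection hM hNA nablaG nabla0.
(* Both maps have the same prescribed components, which determine a vector field. *)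
apply/funext => X; apply/funext => Y.
have [psiXY AXY gXY] := nablaP X Y; have [psiXY' AXY' gXY'] := nablaP' X Y.
apply: (vector_field_components hM hNA) => [||Z psiZ AZ].
- by rewrite psiXY psiXY'.
- by rewrite AXY AXY'.
- by rewrite gXY// gXY'.
Qed.
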